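(* Let $\mathscr{J}$ be a Jacobi matrix with parameters $a_n\in\mathbb{R}$, $b_n>0$ ($n\ge0$) in limit circle case. Then the order of its Nevanlinna matrix $W$ is not less than the convergence exponent of $$\left(\frac{b_nb_{n+1}}{\sqrt{a_{n+1}^2+b_n^2+b_{n+1}^2}}\right)_{n=0}^\infty.$$ In particular, the order of $W$ is not less than the convergence exponent of $(b_n)_{n=0}^\infty$.
   Context: The Jacobi matrix $\mathscr{J}$ is the semi-infinite symmetric tridiagonal matrix with diagonal $(a_0,a_1,\dots)$ and off-diagonal $(b_0,b_1,\dots)$, where $a_n\in\mathbb{R}$, $b_n>0$. It is in limit circle case if its minimal operator in $\ell^2$ is symmetric with deficiency indices $(1,1)$ (as opposed to self-adjoint, the limit point case). Let $p_n,q_n$ be the orthogonal polynomials of the first and second kind, i.e. the solutions of $b_nu_{n+1}+a_nu_n+b_{n-1}u_{n-1}=zu_n$, $n\ge1$, with $p_0=1$, $p_1(z)=(z-a_0)/b_0$, $q_0=0$, $q_1=1/b_0$. In limit circle case, the Nevanlinna matrix $W=\begin{pmatrix}A&C\\ B&D\end{pmatrix}$ consists of the entire functions $$A(z)=z\sum_{n=0}^\infty q_n(0)q_n(z),\quad B(z)=-1+z\sum_{n=0}^\infty q_n(0)p_n(z),$$ $$C(z)=1+z\sum_{n=0}^\infty p_n(0)q_n(z),\quad D(z)=z\sum_{n=0}^\infty p_n(0)p_n(z).$$ All four entries $w_{ij}$ of $W$ have the same order $\rho:=\limsup_{r\to\infty}\frac{\log\log\max_{|z|=r}|w_{ij}(z)|}{\log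 r}$, called the order of $W$. The convergence exponent of a sequence $(\lambda_n)$ of nonzero numbers is $\inf\{\alpha>0 : \sum_n|\lambda_n|^{-\alpha}<\infty\}$. *)

(* Defs.v *)
From Stdlib Require Import Reals.
From Coquelicot Require Import Coquelicot.
Open Scope R_scope.

(* Coquelicot's [Series] is real-valued; a complex series converges iff its real
   and imaginary parts do. *)
Definition CSeries (u : nat -> C) : C :=
  (Series (fun n => Re (u n)), Series (fun n => Im (u n))).

Definition ell2 (u : nat -> C) : Prop := ex_series (fun n => (Cmod (u n)) ^ 2).

(* Only meaningful on sequences in l^2. *)
Definition ell2_norm_sq (u : nat -> C) : R := Series (fun n => (Cmod (u n)) ^ 2).

Definition ell2_inner (u v : nat -> C) : C :=
  CSeries (fun n => (u n * Cconj (v n))%C).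

Definition finitely_supported (u : nat -> C) : Prop :=
  exists N : nat, forall n : nat, (N <= n)%nat -> u n = 0%C.

Definition ell2_graph := (nat -> C) -> (nat -> C) -> Prop.

Definition densely_defined (T : ell2_graph) : Prop :=
  forall (u : nat -> C) (eps : R), ell2 u -> 0 < eps ->
    exists v w : nat -> C,
      T v w /\ ell2_norm_sq (fun n => (u n - v n)%C) < eps.

Definition symmetric_operator (T : ell2_graph) : Prop :=
  densely_defined T /\
  forall u v u' v' : nat -> C,
    T u v -> T u' v' -> ell2_inner v u' = ell2_inner u v'.

(* The orthogonal complement in l^2 of the range of T - conj z, that is, the
   kernel of T^* - z. *)
Definition deficiency_space (T : ell2_graph) (z : C) (f : nat -> C) : Prop :=
  ell2 f /\
  forall u v : nat -> C, T u v ->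
    ell2_inner (fun n => (v n - Cconj z * u n)%C) f = 0%C.

(* The basis is e 1, ..., e d; [sum_n_m _ 1 0] is the empty sum. *)
Definition has_dimension (V : (nat -> C) -> Prop) (d : nat) : Prop :=
  exists e : nat -> nat -> C,
    (forall c : nat -> C,
       (forall n : nat, sum_n_m (fun i => (c i * e i n)%C) 1 d = RtoC 0) ->
       forall i : nat, (1 <= i <= d)%nat -> c i = 0%C) /\
    (forall f : nat -> C,
       V f <->
       exists c : nat -> C,
         forall n : nat, f n = sum_n_m (fun i => (c i * e i n)%C) 1 d).

Definition deficiency_indices (T : ell2_graph) (d1 d2 : nat) : Prop :=
  has_dimension (deficiency_space T Ci) d1 /\
  has_dimension (deficiency_space T (- Ci)%C) d2.

(* The formal action on a sequence of the tridiagonal matrix with diagonal a and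
   off-diagonal b. *)
Definition jacobi_action (a b : nat -> R) (u : nat -> C) (n : nat) : C :=
  match n with
  | O => (a 0%nat * u 0%nat + b 0%nat * u 1%nat)%C
  | S k => (b k * u k + a (S k) * u (S k) + b (S k) * u (S (S k)))%C
  end.

(* The closure in l^2 x l^2 of the graph of [jacobi_action a b] restricted to
   finitely supported sequences. *)
Definition minimal_operator (a b : nat -> R) : ell2_graph :=
  fun u v =>
    ell2 u /\ ell2 v /\
    exists s : nat -> nat -> C,
      (forall k : nat, finitely_supported (s k)) /\
      is_lim_seq (fun k => ell2_norm_sq (fun n => (s k n - u n)%C)) 0 /\
      is_lim_seq
        (fun k => ell2_norm_sq (fun n => (jacobi_action a b (s k) n - v n)%C)) 0.

Definition limit_circle (a b : nat -> R) : Prop :=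
  symmetric_operator (minimal_operator a b) /\
  deficiency_indices (minimal_operator a b) 1 1.

(* The pair (u_n, u_(n+1)), where b_n u_(n+1) + a_n u_n + b_(n-1) u_(n-1) = z u_n
   for n >= 1. *)
Fixpoint jacobi_solution (a b : nat -> R) (z u0 u1 : C) (n : nat) : C * C :=
  match n with
  | O => (u0, u1)
  | S k =>
      let (x, y) := jacobi_solution a b z u0 u1 k in
      (y, (((z - a (S k)) * y - b k * x) / b (S k))%C)
  end.

Definition poly_p (a b : nat -> R) (n : nat) (z : C) : C :=
  fst (jacobi_solution a b z 1%C ((z - a 0%nat) / b 0%nat)%C n).

Definition poly_q (a b : nat -> R) (n : nat) (z : C) : C :=
  fst (jacobi_solution a b z 0%C (1 / b 0%nat)%C n).

Definition nev_A (a b : nat -> R) (z : C) : C :=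
  (z * CSeries (fun n => poly_q a b n 0 * poly_q a b n z))%C.

Definition nev_B (a b : nat -> R) (z : C) : C :=
  (- (1) + z * CSeries (fun n => poly_q a b n 0 * poly_p a b n z))%C.

Definition nev_C (a b : nat -> R) (z : C) : C :=
  (1 + z * CSeries (fun n => poly_p a b n 0 * poly_q a b n z))%C.

Definition nev_D (a b : nat -> R) (z : C) : C :=
  (z * CSeries (fun n => poly_p a b n 0 * poly_p a b n z))%C.

Definition nevanlinna_matrix (a b : nat -> R) (z : C) : @matrix C 2 2 :=
  [[nev_A a b z, nev_C a b z], [nev_B a b z, nev_D a b z]].

(* The default value of [coeff_mat] is irrelevant for i, j < 2. *)
Definition nevanlinna_entry (a b : nat -> R) (i j : nat) (z : C) : C :=
  coeff_mat (0%C : C) (nevanlinna_matrix a b z) i j.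

(* Finite for entire f, so that the projection of [Rbar] to [R] is harmless. *)
Definition max_modulus (f : C -> C) (r : R) : R :=
  real (Lub_Rbar (fun m => exists z : C, Cmod z = r /\ m = Cmod (f z))).

Definition limsup_p_infty (g : R -> R) : Rbar :=
  Rbar_glb (fun y => exists s : R,
    y = Lub_Rbar (fun x => exists r : R, s <= r /\ x = g r)).

Definition entire_order (f : C -> C) : Rbar :=
  limsup_p_infty (fun r => ln (ln (max_modulus f r)) / ln r).

(* For sequences of nonzero numbers. The value is [p_infty] if no exponent is
   admissible. *)
Definition convergence_exponent (lam : nat -> R) : Rbar :=
  Glb_Rbar (fun alpha =>
    0 < alpha /\ ex_series (fun n => Rpower (Rabs (lam n)) (- alpha))).

(* Main.v *)
Require Import Defs.
From Stdlib Require Import Reals Lra Lia Psatz Classical.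
From Coquelicot Require Import Coquelicot.
Open Scope R_scope.

(** Write [lam n] for the sequence in question. The argument bounds from below
    the growth of the orthogonal polynomials on the imaginary axis, and compares
    that growth with each entry of the Nevanlinna matrix.

    Let [u] be [poly_p] or [poly_q] at the point [i y], and let [k n] be the sum
    of [|u j|^2] over [j <= n]. Green's formula reads
    [b n * Im (u (n+1) * conj (u n)) = y * k n], so that
    [y * k n <= b n * |u n| * |u (n+1)|]. This bound at [n] and at [n+1],
    combined with the recurrence in the row [n+1] to reach [a (n+1)], gives
    [y^2 / (5 * lam n ^2) <= k (n+2) / k n - 1] ([sqsum_two_steps]). The product
    over [n] telescopes: up to a constant factor, the product of the numbers
    [1 + y^2 / (5 * lam n ^2)] is at most the square of the squared norm of [u]
    ([log_product_le_sqsum]).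

    In the limit circle case the squared norm of [u] is finite, and it is at most
    a constant times the square of the modulus of either coordinate of [u] with
    respect to the solutions at [0] ([sqsum_le_coord]). Indeed [y * k n] is the
    imaginary part of the product of one coordinate with the conjugate of the
    other, while each coordinate is controlled through the Cauchy-Schwarz
    inequality by [y] and the norm. The limits of the coordinates are the four
    entries: [nev_B], [nev_D] for [poly_p] and [nev_A], [nev_C] for [poly_q]. So
    the logarithm of the product is at most a constant plus four times the
    logarithm of the maximum modulus of any chosen entry, and a dyadic summation
    turns this into the comparison of exponents
    ([convergence_exponent_le_order]).

    Finiteness of the norms comes from the deficiency indices. A deficiency
    vector at [i] is a multiple of [poly_p]. The truncated form of Weyl's
    argument then makes [poly_q] square summable at [i] ([weyl_poly_q]), and
    variation of constants carries square summability to every point.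

    The statement on [b] follows from [lam n <= b n]. *)

(** * Solutions of the three-term recurrence *)

(** [u] solves the recurrence of [a], [b] at the spectral parameter [z] from
    the row of index 1 on; the row of index 0 is not imposed. *)
Definition solution (a b : nat -> R) (z : C) (u : nat -> C) : Prop :=
  forall n : nat,
    (b (S n) * u (S (S n)) = (z - a (S n)) * u (S n) - b n * u n)%C.

(** The defect of [u] in the row of index 0. *)
Definition row0_defect (a b : nat -> R) (z : C) (u : nat -> C) : C :=
  (b 0%nat * u 1%nat - (z - a 0%nat) * u 0%nat)%C.

(** Partial sums of the squared [l^2] norm. *)
Definition sqsum (u : nat -> C) (n : nat) : R :=
  sum_n (fun k => Cmod (u k) ^ 2) n.

Lemma sum_n_S_R (f : nat -> R) n : sum_n f (S n) = sum_n f n + f (S n).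
Proof. now rewrite sum_Sn. Qed.

Lemma sum_n_S_C (f : nat -> C) n :
  sum_n f (S n) = (sum_n f n + f (S n))%C.
Proof. now rewrite sum_Sn. Qed.

Lemma sqsum_0 u : sqsum u 0 = Cmod (u 0%nat) ^ 2.
Proof. unfold sqsum; now rewrite sum_O. Qed.

Lemma sqsum_S u n : sqsum u (S n) = sqsum u n + Cmod (u (S n)) ^ 2.
Proof. unfold sqsum; now rewrite sum_n_S_R. Qed.

Lemma sqsum_term_le u n : Cmod (u n) ^ 2 <= sqsum u n.
Proof.
  assert (H : forall m, 0 <= sqsum u m).
  { induction m as [|m IH]; [rewrite sqsum_0 | rewrite sqsum_S];
      pose proof (pow2_ge_0 (Cmod (u 0%nat)));
      try pose proof (pow2_ge_0 (Cmod (u (S m)))); lra. }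
  destruct n as [|n]; [rewrite sqsum_0; lra|].
  rewrite sqsum_S; specialize (H n); lra.
Qed.

Lemma sqsum_nonneg u n : 0 <= sqsum u n.
Proof. apply Rle_trans with (2 := sqsum_term_le u n), pow2_ge_0. Qed.

Lemma sqsum_le u n m : (n <= m)%nat -> sqsum u n <= sqsum u m.
Proof.
  induction 1 as [|m _ IH]; [lra|].
  rewrite sqsum_S; pose proof (pow2_ge_0 (Cmod (u (S m)))); lra.
Qed.

Lemma RtoC_neq_0 (x : R) : x <> 0 -> RtoC x <> 0%C.
Proof. intros H E; apply H; now apply RtoC_inj. Qed.

Lemma Cmult_reg_l (c x y : C) : c <> 0%C -> (c * x = c * y)%C -> x = y.
Proof.
  intros Hc H.
  replace x with (/ c * (c * x))%C by (field; exact Hc).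
  rewrite H; field; exact Hc.
Qed.

Section Recurrence.

Variables (a b : nat -> R).
Hypothesis b_pos : forall n, 0 < b n.

Let bC_neq_0 n : RtoC (b n) <> 0%C.
Proof. apply RtoC_neq_0; specialize (b_pos n); lra. Qed.

Lemma jacobi_solution_snd z u0 u1 n :
  snd (jacobi_solution a b z u0 u1 n) = fst (jacobi_solution a b z u0 u1 (S n)).
Proof. simpl; now destruct (jacobi_solution a b z u0 u1 n). Qed.

Lemma jacobi_solution_solution z u0 u1 :
  solution a b z (fun n => fst (jacobi_solution a b z u0 u1 n)).
Proof.
  intro n; rewrite <- (jacobi_solution_snd z u0 u1 (S n)).
  simpl; destruct (jacobi_solution a b z u0 u1 n) as [x y]; simpl.
  field; apply bC_neq_0.
Qed.

Lemma poly_p_solution z : solution a b z (fun n => poly_p a b n z).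
Proof. apply jacobi_solution_solution. Qed.

Lemma poly_q_solution z : solution a b z (fun n => poly_q a b n z).
Proof. apply jacobi_solution_solution. Qed.

Lemma poly_p_row0 z : row0_defect a b z (fun n => poly_p a b n z) = 0%C.
Proof. unfold row0_defect, poly_p; simpl; field; apply bC_neq_0. Qed.

Lemma poly_q_row0 z : row0_defect a b z (fun n => poly_q a b n z) = 1%C.
Proof. unfold row0_defect, poly_q; simpl; field; apply bC_neq_0. Qed.

Lemma wronskian z n :
  (b n * (poly_p a b n z * poly_q a b (S n) z
          - poly_p a b (S n) z * poly_q a b n z))%C = 1%C.
Proof.
  induction n as [|n IH].
  - unfold poly_p, poly_q; simpl; field; apply bC_neq_0.
  - rewrite <- IH.
    pose proof (poly_p_solution z n) as Hp; pose proof (poly_q_solution z n) as Hq.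
    cbv beta in Hp, Hq.
    set (p0 := poly_p a b n z) in *; set (p1 := poly_p a b (S n) z) in *.
    set (p2 := poly_p a b (S (S n)) z) in *.
    set (q0 := poly_q a b n z) in *; set (q1 := poly_q a b (S n) z) in *.
    set (q2 := poly_q a b (S (S n)) z) in *.
    transitivity (p1 * (b (S n) * q2) - (b (S n) * p2) * q1)%C; [ring|].
    rewrite Hp, Hq; ring.
Qed.

(** ** Variation of constants *)

(** The coordinates of a solution at [z] with respect to the solutions
    [- poly_p] and [poly_q] at the base point [w]. With [w = 0] and [u] equal to
    [poly_p] or [poly_q], these are the partial sums of the Nevanlinna
    functions. *)
Definition coord_p (z w : C) (u : nat -> C) (n : nat) : C :=
  (- u 0%nat + (z - w) * sum_n (fun k => poly_q a b k w * u k)%C n)%C.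

Definition coord_q (z w : C) (u : nat -> C) (n : nat) : C :=
  (row0_defect a b z u + (z - w) * sum_n (fun k => poly_p a b k w * u k)%C n)%C.

Lemma variation_of_constants z w u n : solution a b z u ->
  u n = (- coord_p z w u n * poly_p a b n w
         + coord_q z w u n * poly_q a b n w)%C /\
  u (S n) = (- coord_p z w u n * poly_p a b (S n) w
             + coord_q z w u n * poly_q a b (S n) w)%C.
Proof.
  intro Hu; induction n as [|n [IH0 IH1]].
  - unfold coord_p, coord_q; rewrite !sum_O.
    unfold row0_defect, poly_p, poly_q; simpl; split; [ring|].
    field; apply bC_neq_0.
  - unfold coord_p, coord_q in *; rewrite !sum_n_S_C.
    pose proof (wronskian w (S n)) as W.
    pose proof (poly_p_solution w n) as Hp; pose proof (poly_q_solution w n) as Hq.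
    pose proof (Hu n) as Hn.
    cbv beta in Hp, Hq.
    set (al := (- u 0%nat + (z - w) * sum_n (fun k => poly_q a b k w * u k) n)%C) in *.
    set (ga := (row0_defect a b z u
                + (z - w) * sum_n (fun k => poly_p a b k w * u k) n)%C) in *.
    replace (- u 0%nat + (z - w) * (sum_n (fun k => poly_q a b k w * u k) n
              + poly_q a b (S n) w * u (S n)))%C
      with (al + (z - w) * (poly_q a b (S n) w * u (S n)))%C by (unfold al; ring).
    replace (row0_defect a b z u + (z - w) * (sum_n (fun k => poly_p a b k w * u k) n
              + poly_p a b (S n) w * u (S n)))%C
      with (ga + (z - w) * (poly_p a b (S n) w * u (S n)))%C by (unfold ga; ring).
    clearbody al ga.
    set (p0 := poly_p a b n w) in *; set (p1 := poly_p a b (S n) w) in *.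
    set (p2 := poly_p a b (S (S n)) w) in *.
    set (q0 := poly_q a b n w) in *; set (q1 := poly_q a b (S n) w) in *.
    set (q2 := poly_q a b (S (S n)) w) in *.
    split; [rewrite IH1; ring|].
    apply (Cmult_reg_l (b (S n))); [apply bC_neq_0|].
    rewrite Hn.
    transitivity (- al * (b (S n) * p2) + ga * (b (S n) * q2)
                  + (z - w) * u (S n) * (b (S n) * (p1 * q2 - p2 * q1)))%C; [|ring].
    rewrite W, Hp, Hq, IH0, IH1; ring.
Qed.

Lemma coord_p_S z w u n :
  coord_p z w u (S n)
  = (coord_p z w u n + (z - w) * (poly_q a b (S n) w * u (S n)))%C.
Proof. unfold coord_p; rewrite sum_n_S_C; ring. Qed.

Lemma coord_q_S z w u n :
  coord_q z w u (S n)
  = (coord_q z w u n + (z - w) * (poly_p a b (S n) w * u (S n)))%C.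
Proof. unfold coord_q; rewrite sum_n_S_C; ring. Qed.

(** Squared size of the fundamental system at [w]; its sum is finite if and
    only if all solutions at [w] are square summable. *)
Definition fund (w : C) (n : nat) : R :=
  (Cmod (poly_p a b n w) + Cmod (poly_q a b n w)) ^ 2.

Lemma coord_bound z w u n : solution a b z u ->
  Cmod (coord_p z w u n) + Cmod (coord_q z w u n)
  <= (Cmod (u 0%nat) + Cmod (row0_defect a b z u))
     * exp (Cmod (z - w) * sum_n (fund w) n).
Proof.
  intro Hu.
  assert (Hexp : forall x y, 0 <= y -> exp x * (1 + y) <= exp (x + y)).
  { intros x y Hy; rewrite exp_plus.
    apply Rmult_le_compat_l; [left; apply exp_pos | apply exp_ineq1_le]. }
  set (d := Cmod (z - w)).
  assert (Hd : 0 <= d) by apply Cmod_ge_0.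
  set (s0 := Cmod (u 0%nat) + Cmod (row0_defect a b z u)).
  assert (Hs0 : 0 <= s0).
  { unfold s0; pose proof (Cmod_ge_0 (u 0%nat));
      pose proof (Cmod_ge_0 (row0_defect a b z u)); lra. }
  induction n as [|n IH].
  - rewrite sum_O.
    replace (fund w 0) with 1.
    2: { unfold fund, poly_p, poly_q; simpl fst; rewrite Cmod_1, Cmod_0; ring. }
    unfold coord_p, coord_q; rewrite !sum_O.
    replace (poly_q a b 0 w) with (RtoC 0) by reflexivity.
    replace (poly_p a b 0 w) with (RtoC 1) by reflexivity.
    replace (- u 0%nat + (z - w) * (0 * u 0%nat))%C with (- u 0%nat)%C by ring.
    rewrite Cmod_opp.
    pose proof (Cmod_triangle (row0_defect a b z u) ((z - w) * (1 * u 0%nat))) as Ht.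
    rewrite !Cmod_mult, Cmod_1 in Ht; fold d in Ht.
    pose proof (Hexp 0 (d * 1)) as He; rewrite exp_0, Rplus_0_l in He.
    specialize (He ltac:(lra)).
    pose proof (Rmult_le_compat_l s0 _ _ Hs0 He) as H1.
    apply Rle_trans with (2 := H1); unfold s0.
    pose proof (Cmod_ge_0 (row0_defect a b z u)); nra.
  - rewrite coord_p_S, coord_q_S, sum_n_S_R.
    destruct (variation_of_constants z w u n Hu) as [_ H1].
    set (P := poly_p a b (S n) w) in *; set (Q := poly_q a b (S n) w) in *.
    set (al := coord_p z w u n) in *; set (ga := coord_q z w u n) in *.
    assert (Hg : fund w (S n) = (Cmod P + Cmod Q) ^ 2) by reflexivity.
    rewrite Hg, Rmult_plus_distr_l.
    assert (Hu1 : Cmod (u (S n)) <= (Cmod al + Cmod ga) * (Cmod P + Cmod Q)).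
    { rewrite H1; eapply Rle_trans; [apply Cmod_triangle|].
      rewrite !Cmod_mult, Cmod_opp.
      pose proof (Cmod_ge_0 al); pose proof (Cmod_ge_0 ga);
      pose proof (Cmod_ge_0 P); pose proof (Cmod_ge_0 Q); nra. }
    pose proof (Cmod_triangle al ((z - w) * (Q * u (S n)))) as T1.
    pose proof (Cmod_triangle ga ((z - w) * (P * u (S n)))) as T2.
    rewrite !Cmod_mult in T1, T2; fold d in T1, T2.
    set (e := Cmod P + Cmod Q) in *.
    assert (He : 0 <= e).
    { unfold e; pose proof (Cmod_ge_0 P); pose proof (Cmod_ge_0 Q); lra. }
    pose proof (Rmult_le_compat_l (d * e) _ _ (Rmult_le_pos _ _ Hd He) Hu1) as H2.
    apply Rle_trans with ((Cmod al + Cmod ga) * (1 + d * e ^ 2)).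
    { unfold e in *; nra. }
    eapply Rle_trans.
    { apply Rmult_le_compat_r; [|exact IH]. pose proof (pow2_ge_0 e); nra. }
    rewrite Rmult_assoc; apply Rmult_le_compat_l; [exact Hs0|].
    apply Hexp, Rmult_le_pos; [exact Hd | apply pow2_ge_0].
Qed.

Lemma solution_bound z w u n : solution a b z u ->
  Cmod (u n) ^ 2
  <= ((Cmod (u 0%nat) + Cmod (row0_defect a b z u))
     * exp (Cmod (z - w) * sum_n (fund w) n)) ^ 2 * fund w n.
Proof.
  intro Hu.
  pose proof (coord_bound z w u n Hu) as Hc.
  destruct (variation_of_constants z w u n Hu) as [H1 _].
  unfold fund at 2; rewrite <- Rpow_mult_distr.
  apply pow_incr; split; [apply Cmod_ge_0|].
  rewrite H1 at 1.
  eapply Rle_trans; [apply Cmod_triangle|].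
  rewrite !Cmod_mult, Cmod_opp.
  set (P := poly_p a b n w) in *; set (Q := poly_q a b n w) in *.
  pose proof (Cmod_ge_0 P); pose proof (Cmod_ge_0 Q).
  pose proof (Cmod_ge_0 (coord_p z w u n)); pose proof (Cmod_ge_0 (coord_q z w u n)).
  eapply Rle_trans with ((Cmod (coord_p z w u n) + Cmod (coord_q z w u n)) * (Cmod P + Cmod Q)).
  - nra.
  - apply Rmult_le_compat_r; lra.
Qed.

End Recurrence.

(** * Series *)

Lemma ex_series_bounded (f : nat -> R) (M : R) :
  (forall n, 0 <= f n) -> (forall n, sum_n f n <= M) -> ex_series f.
Proof.
  intros Hf HM.
  destruct (ex_finite_lim_seq_incr (sum_n f) M) as [l Hl].
  - intro n; rewrite sum_n_S_R; specialize (Hf (S n)); lra.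
  - exact HM.
  - exists l; exact Hl.
Qed.

Lemma sum_n_le_Series (f : nat -> R) n :
  (forall n, 0 <= f n) -> ex_series f -> sum_n f n <= Series f.
Proof.
  intros Hf Hex; apply Series_correct in Hex.
  assert (H : Rbar_le (sum_n f n) (Series f)); [|exact H].
  apply is_lim_seq_le_loc with (u := fun _ => sum_n f n) (v := sum_n f).
  - exists n; induction 1 as [|m _ IH]; [lra|].
    rewrite sum_n_S_R; specialize (Hf (S m)); lra.
  - apply is_lim_seq_const.
  - exact Hex.
Qed.

Lemma Re_sum_n (f : nat -> C) n : Re (sum_n f n) = sum_n (fun k => Re (f k)) n.
Proof.
  induction n as [|n IH]; [now rewrite !sum_O|].
  rewrite sum_n_S_R, sum_n_S_C, <- IH; reflexivity.
Qed.

Lemma Im_sum_n (f : nat -> C) n : Im (sum_n f n) = sum_n (fun k => Im (f k)) n.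
Proof.
  induction n as [|n IH]; [now rewrite !sum_O|].
  rewrite sum_n_S_R, sum_n_S_C, <- IH; reflexivity.
Qed.

Lemma is_series_finite (f : nat -> R) N :
  (forall n, (N < n)%nat -> f n = 0) -> is_series f (sum_n f N).
Proof.
  intro Hf.
  assert (H : is_lim_seq (sum_n f) (sum_n f N)); [|exact H].
  apply is_lim_seq_ext_loc with (u := fun _ => sum_n f N);
    [|apply is_lim_seq_const].
  exists N; induction 1 as [|m Hm IH]; [reflexivity|].
  rewrite sum_n_S_R, <- IH, (Hf (S m)) by lia; symmetry; apply Rplus_0_r.
Qed.

Lemma CSeries_finite (u : nat -> C) N :
  (forall n, (N < n)%nat -> u n = 0%C) -> CSeries u = sum_n u N.
Proof.
  intro Hu; unfold CSeries.
  rewrite (is_series_unique _ _ (is_series_finite (fun n => Re (u n)) N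
             ltac:(intros n Hn; cbv beta; now rewrite (Hu n Hn)))).
  rewrite (is_series_unique _ _ (is_series_finite (fun n => Im (u n)) N
             ltac:(intros n Hn; cbv beta; now rewrite (Hu n Hn)))).
  rewrite <- Re_sum_n, <- Im_sum_n; now destruct (sum_n u N).
Qed.

Lemma sum_n_last (u : nat -> C) N :
  (forall n, (n < N)%nat -> u n = 0%C) -> sum_n u N = u N.
Proof.
  destruct N as [|N]; intro Hu; [apply sum_O|].
  assert (H : forall n, (n <= N)%nat -> sum_n u n = RtoC 0).
  { induction n as [|n IH]; intro Hn.
    - rewrite sum_O; apply Hu; lia.
    - rewrite sum_n_S_C, IH, Hu by lia; apply Cplus_0_l. }
  rewrite sum_n_S_C, (H N) by lia; apply Cplus_0_l.
Qed.

Lemma sqsum_ell2 u : ell2 u -> exists K, forall n, sqsum u n <= K.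
Proof.
  intro H; exists (Series (fun n => Cmod (u n) ^ 2)); intro n.
  apply sum_n_le_Series; [intro; apply pow2_ge_0 | exact H].
Qed.

(** * The limit circle case *)

Section LimitCircle.

Variables (a b : nat -> R).
Hypothesis b_pos : forall n, 0 < b n.

(** The standard basis of [l^2]. *)
Definition basis_vector (k n : nat) : C := if Nat.eq_dec n k then 1%C else 0%C.

Lemma basis_vector_eq k : basis_vector k k = 1%C.
Proof. unfold basis_vector; destruct (Nat.eq_dec k k); congruence. Qed.

Lemma basis_vector_neq k n : n <> k -> basis_vector k n = 0%C.
Proof. unfold basis_vector; destruct (Nat.eq_dec n k); congruence. Qed.

Lemma ell2_finite u : finitely_supported u -> ell2 u.
Proof.
  intros [N HN]; eexists; apply is_series_finite with (N := N).
  intros n Hn; rewrite HN by lia; rewrite Cmod_0; ring.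
Qed.

Lemma minimal_operator_finite u : finitely_supported u ->
  minimal_operator a b u (jacobi_action a b u).
Proof.
  intro Hu; repeat split.
  - now apply ell2_finite.
  - apply ell2_finite; destruct Hu as [N HN]; exists (S N).
    intros [|n] Hn; [lia|]; simpl.
    rewrite !HN by lia; ring.
  - assert (Z : forall v : nat -> C, ell2_norm_sq (fun n => (v n - v n)%C) = 0).
    { intro v; unfold ell2_norm_sq.
      assert (H0 : forall n, Cmod (v n - v n) ^ 2 = 0).
      { intro n; replace (v n - v n)%C with (RtoC 0) by ring.
        rewrite Cmod_0; ring. }
      rewrite (Series_ext _ _ H0); apply is_series_unique.
      pose proof (is_series_finite (fun _ => 0) 0 (fun _ _ => eq_refl)) as H.
      rewrite sum_O in H; exact H. }
    exists (fun _ => u); split; [intro; exact Hu | split].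
    + apply is_lim_seq_ext with (fun _ => 0); [|apply is_lim_seq_const].
      intros _; now rewrite Z.
    + apply is_lim_seq_ext with (fun _ => 0); [|apply is_lim_seq_const].
      intros _; now rewrite Z.
Qed.

(** Testing orthogonality against the basis vectors shows that a deficiency
    vector at [z] solves the recurrence in every row. *)
Lemma deficiency_solution z f : deficiency_space (minimal_operator a b) z f ->
  solution a b z f /\ row0_defect a b z f = 0%C.
Proof.
  intros [_ Hort].
  set (g := fun k n => (((jacobi_action a b (basis_vector k) n)
                          - Cconj z * basis_vector k n) * Cconj (f n))%C).
  assert (Hk : forall k, sum_n (g k) (S k) = RtoC 0).
  { intro k; rewrite <- (Hort _ _ (minimal_operator_finite (basis_vector k)
      ltac:(exists (S k); intros n Hn; apply basis_vector_neq; lia))).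
    symmetry; apply CSeries_finite; intros n Hn; unfold jacobi_action.
    destruct n as [|n]; [lia|].
    rewrite !basis_vector_neq by lia; ring. }
  assert (Hconj : forall x : C, Cconj x = 0%C -> x = 0%C).
  { intros x Hx; rewrite <- (Cconj_conj x), Hx.
    unfold Cconj; simpl; now rewrite Ropp_0. }
  assert (Cr : forall x : R, Cconj x = x).
  { intro x; unfold Cconj; simpl; now rewrite Ropp_0. }
  split.
  - intro n; specialize (Hk (S n)); rewrite !sum_n_S_C in Hk.
    rewrite sum_n_last in Hk.
    2: { intros m Hm; unfold g, jacobi_action.
         destruct m as [|m]; rewrite !basis_vector_neq by lia; ring. }
    assert (E : forall x y : C, (x - y)%C = 0%C -> x = y).
    { intros x y H; replace x with ((x - y) + y)%C by ring; rewrite H; ring. }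
    apply E, Hconj; rewrite <- Hk; unfold g.
    rewrite !Cminus_conj, !Cmult_conj, Cminus_conj, !Cr.
    replace (jacobi_action a b (basis_vector (S n)) n) with (RtoC (b n)).
    2: { destruct n as [|n]; simpl; rewrite basis_vector_eq, !basis_vector_neq by lia; ring. }
    replace (jacobi_action a b (basis_vector (S n)) (S n)) with (RtoC (a (S n))).
    2: { simpl; rewrite basis_vector_eq, !basis_vector_neq by lia; ring. }
    replace (jacobi_action a b (basis_vector (S n)) (S (S n))) with (RtoC (b (S n))).
    2: { simpl; rewrite basis_vector_eq, !basis_vector_neq by lia; ring. }
    rewrite basis_vector_eq, !basis_vector_neq by lia; ring.
  - specialize (Hk 0%nat); rewrite sum_n_S_C, sum_O in Hk.
    apply Hconj; rewrite <- Hk; unfold g, row0_defect; simpl.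
    rewrite basis_vector_eq, !basis_vector_neq by lia.
    rewrite Cminus_conj, !Cmult_conj, Cminus_conj, !Cr; ring.
Qed.

Lemma solution_row0 z f n : solution a b z f -> row0_defect a b z f = 0%C ->
  f n = (f 0%nat * poly_p a b n z)%C.
Proof.
  intros Hf H0.
  destruct (variation_of_constants a b b_pos z z f n Hf) as [H _].
  rewrite H; unfold coord_p, coord_q; rewrite H0; ring.
Qed.

(** Green's formula for [u] and its conjugate. *)
Lemma green z u n : solution a b z u ->
  b n * Im (u (S n) * Cconj (u n))%C
  = Im z * sqsum u n + Im (row0_defect a b z u * Cconj (u 0%nat))%C.
Proof.
  intro Hu; induction n as [|n IH].
  - rewrite sqsum_0, Cmod2_alt; unfold row0_defect.
    destruct z, (u 0%nat), (u 1%nat); simpl; ring.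
  - rewrite sqsum_S, Rmult_plus_distr_l.
    transitivity (b n * Im (u (S n) * Cconj (u n))%C + Im z * Cmod (u (S n)) ^ 2);
      [|rewrite IH; ring].
    rewrite Cmod2_alt.
    transitivity (Im ((b (S n) * u (S (S n))) * Cconj (u (S n)))%C).
    { destruct (u (S n)), (u (S (S n))); simpl; ring. }
    rewrite Hu; destruct z, (u n), (u (S n)); simpl; ring.
Qed.

Lemma limit_circle_poly_p : limit_circle a b ->
  exists K, forall n, sqsum (fun n => poly_p a b n Ci) n <= K.
Proof.
  intros [_ [[e [Hfree Hspan]] _]].
  assert (S1 : forall u : nat -> C, sum_n_m u 1 1 = u 1%nat).
  { intro u; apply sum_n_n. }
  assert (HV : deficiency_space (minimal_operator a b) Ci (e 1%nat)).
  { apply Hspan; exists (fun _ => 1%C); intro n; rewrite S1; ring. }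
  destruct (deficiency_solution _ _ HV) as [Hs H0].
  assert (He : forall n, e 1%nat n = (e 1%nat 0%nat * poly_p a b n Ci)%C)
    by (intro; now apply solution_row0).
  assert (Hne : e 1%nat 0%nat <> 0%C).
  { intro E.
    assert (H10 : RtoC 1 = 0%C); [|apply RtoC_inj in H10; lra].
    apply (Hfree (fun _ => 1%C)) with (i := 1%nat); [|lia].
    assert (Z : forall c : C, (1 * (0 * c))%C = RtoC 0) by (intro; ring).
    intro n; rewrite S1, He, E; apply Z. }
  destruct HV as [Hl2 _]; destruct (sqsum_ell2 _ Hl2) as [K HK].
  apply Cmod_gt_0 in Hne.
  set (m := Cmod (e 1%nat 0%nat)) in *.
  exists (K / m ^ 2); intro n.
  assert (Hm : 0 < m ^ 2) by (apply pow_lt; exact Hne).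
  apply Rmult_le_reg_l with (m ^ 2); [exact Hm|].
  replace (m ^ 2 * (K / m ^ 2)) with K by (field; lra).
  apply Rle_trans with (2 := HK n); right.
  clear HK; induction n as [|n IH].
  - rewrite !sqsum_0, (He 0%nat) at 1.
    rewrite Cmod_mult, Rpow_mult_distr; reflexivity.
  - rewrite !sqsum_S, Rmult_plus_distr_l, IH, (He (S n)).
    rewrite Cmod_mult, Rpow_mult_distr; reflexivity.
Qed.

(** Weyl's argument: for each [N] the solution [q + m p] vanishing at [N + 1]
    has squared norm [Im m] up to [N], which forces [Cmod m <= 1]. *)
Lemma weyl_poly_q N :
  sqsum (fun n => poly_q a b n Ci) N
  <= 2 + 2 * sqsum (fun n => poly_p a b n Ci) N.
Proof.
  pose proof (green Ci _ N (poly_p_solution a b b_pos Ci)) as Gp.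
  rewrite (poly_p_row0 a b b_pos) in Gp.
  assert (HP : poly_p a b (S N) Ci <> 0%C).
  { intro E; cbv beta in Gp; rewrite E in Gp.
    pose proof (sqsum_le (fun n => poly_p a b n Ci) 0 N ltac:(lia)) as H1.
    rewrite sqsum_0 in H1.
    replace (poly_p a b 0 Ci) with (RtoC 1) in H1 by reflexivity.
    rewrite Cmod_1 in H1.
    replace (0 * Cconj (poly_p a b N Ci))%C with (RtoC 0) in Gp by ring.
    replace (0 * Cconj (poly_p a b 0 Ci))%C with (RtoC 0) in Gp by ring.
    simpl in Gp; lra. }
  set (m := (- poly_q a b (S N) Ci / poly_p a b (S N) Ci)%C).
  set (psi := fun n => (poly_q a b n Ci + m * poly_p a b n Ci)%C).
  assert (Hpsi : solution a b Ci psi).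
  { intro n; pose proof (poly_p_solution a b b_pos Ci n) as Hp.
    pose proof (poly_q_solution a b b_pos Ci n) as Hq; cbv beta in Hp, Hq.
    unfold psi.
    transitivity (b (S n) * poly_q a b (S (S n)) Ci
                  + m * (b (S n) * poly_p a b (S (S n)) Ci))%C; [ring|].
    rewrite Hp, Hq; ring. }
  assert (Hrow : row0_defect a b Ci psi = 1%C).
  { pose proof (poly_p_row0 a b b_pos Ci) as Hp.
    pose proof (poly_q_row0 a b b_pos Ci) as Hq.
    unfold row0_defect in *; unfold psi.
    transitivity ((b 0%nat * poly_q a b 1 Ci - (Ci - a 0%nat) * poly_q a b 0 Ci)
      + m * (b 0%nat * poly_p a b 1 Ci - (Ci - a 0%nat) * poly_p a b 0 Ci))%C; [ring|].
    rewrite Hp, Hq; ring. }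
  pose proof (green Ci psi N Hpsi) as G; rewrite Hrow in G.
  assert (E0 : psi 0%nat = m).
  { unfold psi, poly_q, poly_p; simpl; ring. }
  assert (EN : psi (S N) = 0%C) by (unfold psi, m; field; exact HP).
  rewrite EN, E0 in G.
  replace (0 * Cconj (psi N))%C with (RtoC 0) in G by ring.
  assert (HIm : sqsum psi N = Im m).
  { revert G; destruct m as [m1 m2]; simpl; lra. }
  assert (Hm1 : Cmod m ^ 2 <= Im m).
  { rewrite <- HIm, <- E0, <- sqsum_0; apply sqsum_le; lia. }
  assert (Hm2 : Im m <= 1 /\ Cmod m ^ 2 <= 1).
  { rewrite Cmod2_alt in *; split; nra. }
  assert (Hsum : forall n, sqsum (fun n => poly_q a b n Ci) n
      <= 2 * sqsum psi n + 2 * sqsum (fun n => poly_p a b n Ci) n).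
  { assert (Ht : forall n, Cmod (poly_q a b n Ci) ^ 2
       <= 2 * Cmod (psi n) ^ 2 + 2 * Cmod (poly_p a b n Ci) ^ 2).
    { intro n.
      pose proof (Cmod_triangle (psi n) (- (m * poly_p a b n Ci))) as T.
      replace (psi n + - (m * poly_p a b n Ci))%C with (poly_q a b n Ci) in T
        by (unfold psi; ring).
      rewrite Cmod_opp, Cmod_mult in T.
      pose proof (Cmod_ge_0 (poly_q a b n Ci)).
      pose proof (Cmod_ge_0 (psi n)); pose proof (Cmod_ge_0 (poly_p a b n Ci)).
      pose proof (Cmod_ge_0 m).
      assert (Cmod m <= 1) by nra.
      assert (T' : Cmod (poly_q a b n Ci) <= Cmod (psi n) + Cmod (poly_p a b n Ci)) by nra.
      apply Rle_trans with ((Cmod (psi n) + Cmod (poly_p a b n Ci)) ^ 2).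
      - apply pow_incr; split; assumption.
      - pose proof (pow2_ge_0 (Cmod (psi n) - Cmod (poly_p a b n Ci))); lra. }
    induction n as [|n IH].
    - rewrite !sqsum_0; apply Ht.
    - rewrite !sqsum_S; specialize (Ht (S n)); lra. }
  specialize (Hsum N); lra.
Qed.

(** Square summability of all solutions at [w] is transported to any other
    spectral parameter. *)
Lemma sqsum_solution_bound z w u F n : solution a b z u ->
  (forall n, sum_n (fund a b w) n <= F) ->
  sqsum u n <= ((Cmod (u 0%nat) + Cmod (row0_defect a b z u))
                * exp (Cmod (z - w) * F)) ^ 2 * F.
Proof.
  intros Hu HF.
  set (s0 := Cmod (u 0%nat) + Cmod (row0_defect a b z u)).
  set (c := (s0 * exp (Cmod (z - w) * F)) ^ 2).
  assert (Hfund : forall n, 0 <= fund a b w n) by (intro; apply pow2_ge_0).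
  assert (Ht : forall n, Cmod (u n) ^ 2 <= c * fund a b w n).
  { intro k; eapply Rle_trans; [apply (solution_bound a b b_pos z w u k Hu)|].
    apply Rmult_le_compat_r; [apply Hfund|].
    assert (0 <= s0).
    { unfold s0; pose proof (Cmod_ge_0 (u 0%nat));
        pose proof (Cmod_ge_0 (row0_defect a b z u)); lra. }
    apply pow_incr; split.
    - apply Rmult_le_pos; [exact H | left; apply exp_pos].
    - apply Rmult_le_compat_l; [exact H|].
      assert (Hl : Cmod (z - w) * sum_n (fund a b w) k <= Cmod (z - w) * F).
      { apply Rmult_le_compat_l; [apply Cmod_ge_0 | apply HF]. }
      destruct Hl as [Hl|Hl]; [left; now apply exp_increasing | rewrite Hl; lra]. }
  apply Rle_trans with (c * sum_n (fund a b w) n).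
  - clear - Ht; induction n as [|n IH].
    + rewrite sqsum_0, sum_O; apply Ht.
    + rewrite sqsum_S, sum_n_S_R; specialize (Ht (S n)); lra.
  - apply Rmult_le_compat_l; [apply pow2_ge_0 | apply HF].
Qed.

Lemma sum_fund_le w n :
  sum_n (fund a b w) n
  <= 2 * sqsum (fun n => poly_p a b n w) n + 2 * sqsum (fun n => poly_q a b n w) n.
Proof.
  assert (H : forall n, fund a b w n
    <= 2 * Cmod (poly_p a b n w) ^ 2 + 2 * Cmod (poly_q a b n w) ^ 2).
  { intro k; unfold fund.
    pose proof (pow2_ge_0 (Cmod (poly_p a b k w) - Cmod (poly_q a b k w))); nra. }
  induction n as [|n IH].
  - rewrite !sqsum_0, sum_O; apply H.
  - rewrite !sqsum_S, sum_n_S_R; specialize (H (S n)); lra.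
Qed.

Lemma limit_circle_fund : limit_circle a b ->
  exists F, forall n, sum_n (fund a b 0) n <= F.
Proof.
  intro Hlc; destruct (limit_circle_poly_p Hlc) as [K HK].
  assert (HF : forall n, sum_n (fund a b Ci) n <= 4 + 6 * K).
  { intro n; pose proof (sum_fund_le Ci n); pose proof (weyl_poly_q n).
    specialize (HK n); lra. }
  eexists; intro n; eapply Rle_trans; [apply sum_fund_le|].
  apply Rplus_le_compat; (apply Rmult_le_compat_l; [lra|]).
  - exact (sqsum_solution_bound 0 Ci _ _ n (poly_p_solution a b b_pos 0) HF).
  - exact (sqsum_solution_bound 0 Ci _ _ n (poly_q_solution a b b_pos 0) HF).
Qed.

End LimitCircle.

(** * Growth of solutions along the imaginary axis *)

(** The sequence whose convergence exponent is compared with the order. *)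
Definition jacobi_lambda (a b : nat -> R) (n : nat) : R :=
  b n * b (S n) / sqrt (a (S n) ^ 2 + b n ^ 2 + b (S n) ^ 2).

Lemma cauchy_schwarz_sum (x u : nat -> C) n :
  Cmod (sum_n (fun k => x k * u k)%C n) ^ 2 <= sqsum x n * sqsum u n.
Proof.
  induction n as [|n IH].
  - rewrite !sqsum_0, sum_O, Cmod_mult, Rpow_mult_distr; lra.
  - rewrite !sqsum_S, sum_n_S_C.
    set (s := sum_n (fun k => (x k * u k)%C) n) in *.
    pose proof (Cmod_triangle s (x (S n) * u (S n))) as T.
    rewrite Cmod_mult in T.
    pose proof (sqsum_nonneg x n) as HA; pose proof (sqsum_nonneg u n) as HB.
    set (A := sqsum x n) in *; set (B := sqsum u n) in *.
    pose proof (Cmod_ge_0 (x (S n))) as Hx; pose proof (Cmod_ge_0 (u (S n))) as Hv.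
    pose proof (Cmod_ge_0 s) as Hs.
    set (c := Cmod (x (S n))) in *; set (v := Cmod (u (S n))) in *.
    set (t := Cmod s) in *.
    assert (Hcross : 2 * (t * (c * v)) <= A * v ^ 2 + B * c ^ 2).
    { apply Rsqr_incr_0_var.
      - unfold Rsqr.
        pose proof (pow2_ge_0 (A * v ^ 2 - B * c ^ 2)).
        pose proof (Rmult_le_compat_r ((c * v) ^ 2) _ _ (pow2_ge_0 _) IH).
        nra.
      - apply Rplus_le_le_0_compat; apply Rmult_le_pos; auto using pow2_ge_0. }
    apply Rle_trans with ((t + c * v) ^ 2).
    + apply pow_incr; split; [apply Cmod_ge_0 | exact T].
    + nra.
Qed.

(** The series converges absolutely, as the product of two square summable
    sequences; its limit is only needed through squared moduli. *)
Lemma is_lim_seq_affine_Cmod (t z : C) (x u : nat -> C) (X U : R) :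
  (forall n, sqsum x n <= X) -> (forall n, sqsum u n <= U) ->
  is_lim_seq (fun n => Cmod (t + z * sum_n (fun k => x k * u k)%C n) ^ 2)
             (Cmod (t + z * CSeries (fun k => x k * u k)%C) ^ 2).
Proof.
  intros HX HU.
  set (f := fun k => (x k * u k)%C).
  assert (Hf : ex_series (fun k => Cmod (f k))).
  { apply ex_series_bounded with (X + U); [intro; apply Cmod_ge_0|].
    intro n; apply Rle_trans with (sqsum x n + sqsum u n);
      [|apply Rplus_le_compat; auto].
    assert (H : forall k, Cmod (f k) <= Cmod (x k) ^ 2 + Cmod (u k) ^ 2).
    { intro k; unfold f; rewrite Cmod_mult.
      pose proof (pow2_ge_0 (Cmod (x k) - Cmod (u k))).
      pose proof (pow2_ge_0 (Cmod (x k))); pose proof (pow2_ge_0 (Cmod (u k))); nra. }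
    induction n as [|n IH].
    - rewrite !sqsum_0, sum_O; apply H.
    - rewrite !sqsum_S, sum_n_S_R; specialize (H (S n)); lra. }
  assert (HRe : ex_series (fun k => Re (f k))).
  { apply (ex_series_le (V := R_CompleteNormedModule)) with (2 := Hf).
    intro k; apply (Rle_trans _ (Rmax (Rabs (Re (f k))) (Rabs (Im (f k)))));
      [apply Rmax_l | apply Rmax_Cmod]. }
  assert (HIm : ex_series (fun k => Im (f k))).
  { apply (ex_series_le (V := R_CompleteNormedModule)) with (2 := Hf).
    intro k; apply (Rle_trans _ (Rmax (Rabs (Re (f k))) (Rabs (Im (f k)))));
      [apply Rmax_r | apply Rmax_Cmod]. }
  apply Series_correct in HRe; apply Series_correct in HIm.
  assert (LRe : is_lim_seq (fun n => Re (sum_n f n)) (Series (fun k => Re (f k)))).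
  { apply is_lim_seq_ext with (sum_n (fun k => Re (f k))).
    - intro n; symmetry; apply Re_sum_n.
    - exact HRe. }
  assert (LIm : is_lim_seq (fun n => Im (sum_n f n)) (Series (fun k => Im (f k)))).
  { apply is_lim_seq_ext with (sum_n (fun k => Im (f k))).
    - intro n; symmetry; apply Im_sum_n.
    - exact HIm. }
  set (sr := Series (fun k => Re (f k))) in *.
  set (si := Series (fun k => Im (f k))) in *.
  assert (Hq : forall s : C, Cmod (t + z * s) ^ 2
    = (Re t + (Re z * Re s - Im z * Im s)) * (Re t + (Re z * Re s - Im z * Im s))
      + (Im t + (Re z * Im s + Im z * Re s)) * (Im t + (Re z * Im s + Im z * Re s))).
  { intro s; rewrite Cmod2_alt; destruct t, z, s; simpl; ring. }
  rewrite Hq.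
  apply is_lim_seq_ext with (fun n => let s := sum_n f n in
      (Re t + (Re z * Re s - Im z * Im s)) * (Re t + (Re z * Re s - Im z * Im s))
      + (Im t + (Re z * Im s + Im z * Re s)) * (Im t + (Re z * Im s + Im z * Re s))).
  { intro n; symmetry; apply Hq. }
  assert (L1 : is_lim_seq
    (fun n => Re t + (Re z * Re (sum_n f n) - Im z * Im (sum_n f n)))
    (Re t + (Re z * sr - Im z * si))).
  { apply is_lim_seq_plus'; [apply is_lim_seq_const|].
    apply is_lim_seq_minus'; apply is_lim_seq_mult'; auto using is_lim_seq_const. }
  assert (L2 : is_lim_seq
    (fun n => Im t + (Re z * Im (sum_n f n) + Im z * Re (sum_n f n)))
    (Im t + (Re z * si + Im z * sr))).
  { apply is_lim_seq_plus'; [apply is_lim_seq_const|].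
    apply is_lim_seq_plus'; apply is_lim_seq_mult'; auto using is_lim_seq_const. }
  change (Re (CSeries f)) with sr; change (Im (CSeries f)) with si; cbv zeta.
  apply is_lim_seq_plus'; apply is_lim_seq_mult'; assumption.
Qed.

Section Growth.

Variables (a b : nat -> R).
Hypothesis b_pos : forall n, 0 < b n.

Lemma jacobi_lambda_pos n : 0 < jacobi_lambda a b n.
Proof.
  pose proof (b_pos n); pose proof (b_pos (S n)).
  apply Rdiv_lt_0_compat; [now apply Rmult_lt_0_compat|].
  apply sqrt_lt_R0; nra.
Qed.

Lemma jacobi_lambda_sq n :
  jacobi_lambda a b n ^ 2 * (a (S n) ^ 2 + b n ^ 2 + b (S n) ^ 2)
  = (b n * b (S n)) ^ 2.
Proof.
  pose proof (b_pos n); pose proof (b_pos (S n)).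
  unfold jacobi_lambda.
  assert (0 < a (S n) ^ 2 + b n ^ 2 + b (S n) ^ 2) by nra.
  set (r := a (S n) ^ 2 + b n ^ 2 + b (S n) ^ 2) in *.
  pose proof (sqrt_lt_R0 r ltac:(assumption)).
  rewrite <- (pow2_sqrt r) at 2 by lra.
  field; lra.
Qed.

Lemma jacobi_lambda_le n : jacobi_lambda a b n <= b n.
Proof.
  pose proof (b_pos n); pose proof (b_pos (S n)).
  pose proof (jacobi_lambda_pos n); pose proof (jacobi_lambda_sq n) as Hs.
  apply Rsqr_incr_0_var; [|lra]; unfold Rsqr.
  apply Rmult_le_reg_r with (b (S n) ^ 2); [nra|].
  pose proof (pow2_ge_0 (jacobi_lambda a b n)) as H3.
  pose proof (pow2_ge_0 (a (S n))); pose proof (pow2_ge_0 (b n)).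
  nra.
Qed.

Lemma solution_real z u : Im z = 0 -> solution a b z u ->
  Im (u 0%nat) = 0 -> Im (u 1%nat) = 0 -> forall n, Im (u n) = 0.
Proof.
  intros Hz Hu H0 H1.
  enough (H : forall n, Im (u n) = 0 /\ Im (u (S n)) = 0) by (intro n; apply H).
  induction n as [|n [IH1 IH2]]; [tauto|]; split; [exact IH2|].
  apply (Rmult_eq_reg_l (b (S n))); [|specialize (b_pos (S n)); lra].
  transitivity (Im (b (S n) * u (S (S n)))%C).
  { destruct (u (S (S n))); simpl; ring. }
  rewrite Hu; destruct z, (u n), (u (S n)); simpl in *; subst; ring.
Qed.

Lemma poly_p_real n : Im (poly_p a b n 0) = 0.
Proof.
  assert (Hb : b 0%nat <> 0) by (specialize (b_pos 0%nat); lra).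
  apply (solution_real 0 (fun n => poly_p a b n 0)); try reflexivity.
  - now apply poly_p_solution.
  - replace (poly_p a b 1 0) with (RtoC (- a 0%nat / b 0%nat)); [reflexivity|].
    unfold poly_p; simpl; rewrite RtoC_div, RtoC_opp by exact Hb.
    field; now apply RtoC_neq_0.
Qed.

Lemma poly_q_real n : Im (poly_q a b n 0) = 0.
Proof.
  assert (Hb : b 0%nat <> 0) by (specialize (b_pos 0%nat); lra).
  apply (solution_real 0 (fun n => poly_q a b n 0)); try reflexivity.
  - now apply poly_q_solution.
  - replace (poly_q a b 1 0) with (RtoC (1 / b 0%nat)); [reflexivity|].
    unfold poly_q; simpl; rewrite RtoC_div by exact Hb; reflexivity.
Qed.

(** The Christoffel-Darboux formula in the coordinates at the base point 0. *)
Lemma green_coord z u n : solution a b z u ->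
  b n * Im (u (S n) * Cconj (u n))%C
  = Im (coord_p a b z 0 u n * Cconj (coord_q a b z 0 u n))%C.
Proof.
  intro Hu.
  destruct (variation_of_constants a b b_pos z 0 u n Hu) as [H1 H2].
  rewrite H2, H1 at 1.
  pose proof (poly_p_real n) as P0; pose proof (poly_p_real (S n)) as P1.
  pose proof (poly_q_real n) as Q0; pose proof (poly_q_real (S n)) as Q1.
  transitivity
    (Re (b n * (poly_p a b n 0 * poly_q a b (S n) 0
                - poly_p a b (S n) 0 * poly_q a b n 0))%C
     * Im (coord_p a b z 0 u n * Cconj (coord_q a b z 0 u n))%C).
  - destruct (poly_p a b n 0), (poly_p a b (S n) 0), (poly_q a b n 0),
      (poly_q a b (S n) 0), (coord_p a b z 0 u n), (coord_q a b z 0 u n).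
    simpl in *; subst; ring.
  - rewrite wronskian by exact b_pos; apply Rmult_1_l.
Qed.

Lemma sqsum_poly_le_fund w n :
  sqsum (fun n => poly_p a b n w) n <= sum_n (fund a b w) n /\
  sqsum (fun n => poly_q a b n w) n <= sum_n (fund a b w) n.
Proof.
  assert (H : forall k, Cmod (poly_p a b k w) ^ 2 <= fund a b w k /\
                        Cmod (poly_q a b k w) ^ 2 <= fund a b w k).
  { intro k; unfold fund.
    pose proof (Cmod_ge_0 (poly_p a b k w)); pose proof (Cmod_ge_0 (poly_q a b k w)).
    split; nra. }
  induction n as [|n IH].
  - rewrite !sqsum_0, sum_O; apply H.
  - rewrite !sqsum_S, sum_n_S_R; specialize (H (S n)); lra.
Qed.

(** The limits of [coord_p] and [coord_q] at the base point 0. *)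
Definition limit_coord_p (z : C) (u : nat -> C) : C :=
  (- u 0%nat + z * CSeries (fun k => poly_q a b k 0 * u k)%C)%C.

Definition limit_coord_q (z : C) (u : nat -> C) : C :=
  (row0_defect a b z u + z * CSeries (fun k => poly_p a b k 0 * u k)%C)%C.

Variable F : R.
Hypothesis fund_bound : forall n, sum_n (fund a b 0) n <= F.

Lemma is_lim_coord_p z u : solution a b z u ->
  is_lim_seq (fun n => Cmod (coord_p a b z 0 u n) ^ 2) (Cmod (limit_coord_p z u) ^ 2).
Proof.
  intro Hu.
  apply is_lim_seq_ext with (fun n =>
    Cmod (- u 0%nat + z * sum_n (fun k => poly_q a b k 0 * u k)%C n) ^ 2).
  { intro n; unfold coord_p; now replace (z - 0)%C with z by ring. }
  eapply is_lim_seq_affine_Cmod with (X := F).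
  - intro n; eapply Rle_trans; [apply sqsum_poly_le_fund | apply fund_bound].
  - intro n; exact (sqsum_solution_bound a b b_pos z 0 u F n Hu fund_bound).
Qed.

Lemma is_lim_coord_q z u : solution a b z u ->
  is_lim_seq (fun n => Cmod (coord_q a b z 0 u n) ^ 2) (Cmod (limit_coord_q z u) ^ 2).
Proof.
  intro Hu.
  apply is_lim_seq_ext with (fun n =>
    Cmod (row0_defect a b z u + z * sum_n (fun k => poly_p a b k 0 * u k)%C n) ^ 2).
  { intro n; unfold coord_q; now replace (z - 0)%C with z by ring. }
  eapply is_lim_seq_affine_Cmod with (X := F).
  - intro n; eapply Rle_trans; [apply sqsum_poly_le_fund | apply fund_bound].
  - intro n; exact (sqsum_solution_bound a b b_pos z 0 u F n Hu fund_bound).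
Qed.

Lemma limit_coord_upper z u : solution a b z u ->
  let M := (Cmod (u 0%nat) + Cmod (row0_defect a b z u)) * exp (Cmod z * F) in
  Cmod (limit_coord_p z u) ^ 2 <= M ^ 2 /\ Cmod (limit_coord_q z u) ^ 2 <= M ^ 2.
Proof.
  intros Hu M.
  assert (HM : forall n,
    Cmod (coord_p a b z 0 u n) + Cmod (coord_q a b z 0 u n) <= M).
  { intro n; eapply Rle_trans; [apply (coord_bound a b b_pos z 0 u n Hu)|].
    apply Rmult_le_compat_l.
    - pose proof (Cmod_ge_0 (u 0%nat)); pose proof (Cmod_ge_0 (row0_defect a b z u)); lra.
    - replace (z - 0)%C with z by ring.
      assert (Hl : Cmod z * sum_n (fund a b 0) n <= Cmod z * F)
        by (apply Rmult_le_compat_l; [apply Cmod_ge_0 | apply fund_bound]).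
      destruct Hl as [Hl|Hl]; [left; now apply exp_increasing | rewrite Hl; lra]. }
  assert (Hpos : forall n, 0 <= Cmod (coord_p a b z 0 u n) /\
                           0 <= Cmod (coord_q a b z 0 u n))
    by (intro; split; apply Cmod_ge_0).
  split.
  - assert (H : Rbar_le (Cmod (limit_coord_p z u) ^ 2) (M ^ 2)); [|exact H].
    apply is_lim_seq_le with (2 := is_lim_coord_p z u Hu) (3 := is_lim_seq_const (M ^ 2)).
    intro n; apply pow_incr; specialize (HM n); specialize (Hpos n); lra.
  - assert (H : Rbar_le (Cmod (limit_coord_q z u) ^ 2) (M ^ 2)); [|exact H].
    apply is_lim_seq_le with (2 := is_lim_coord_q z u Hu) (3 := is_lim_seq_const (M ^ 2)).
    intro n; apply pow_incr; specialize (HM n); specialize (Hpos n); lra.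
Qed.

(** Along the imaginary axis either coordinate alone controls the norm of the
    solution: [Im z] times the squared norm is at most the product of the two
    moduli, and each of them is at most a multiple of [Im z] times the norm. *)
Lemma sqsum_le_coord y u kappa n :
  1 <= y -> solution a b (0, y) u ->
  Im (row0_defect a b (0, y) u * Cconj (u 0%nat))%C = 0 ->
  0 < kappa -> kappa <= sqsum u n ->
  sqsum u n <= (2 * Cmod (row0_defect a b (0, y) u) ^ 2 / kappa + 2 * F)
               * Cmod (coord_p a b (0, y) 0 u n) ^ 2 /\
  sqsum u n <= (2 * Cmod (u 0%nat) ^ 2 / kappa + 2 * F)
               * Cmod (coord_q a b (0, y) 0 u n) ^ 2.
Proof.
  intros Hy Hu H0 Hk Hkn.
  pose proof (green a b (0, y) u n Hu) as G.
  rewrite (green_coord _ _ _ Hu), H0, Rplus_0_r in G.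
  change (Im (0, y)) with y in G.
  assert (Hprod : y * sqsum u n
    <= Cmod (coord_p a b (0, y) 0 u n) * Cmod (coord_q a b (0, y) 0 u n)).
  { rewrite <- G, <- (Cmod_conj (coord_q a b (0, y) 0 u n)), <- Cmod_mult.
    eapply Rle_trans; [apply Rle_abs|].
    eapply Rle_trans; [|apply Rmax_Cmod]; apply Rmax_r. }
  destruct (sqsum_poly_le_fund 0 n) as [Fp Fq].
  specialize (fund_bound n).
  assert (Hz : Cmod ((0, y) - 0)%C ^ 2 = y ^ 2).
  { rewrite Cmod2_alt; simpl; ring. }
  (* |t + s|^2 <= 2 |t|^2 + 2 |s|^2, with Cauchy-Schwarz for s. *)
  assert (Hcs : forall (t : C) (x : nat -> C), sqsum x n <= F ->
     Cmod (t + ((0, y) - 0) * sum_n (fun k => x k * u k) n)%C ^ 2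
     <= (2 * Cmod t ^ 2 / kappa + 2 * F) * (y ^ 2 * sqsum u n)).
  { intros t x Hx.
    pose proof (cauchy_schwarz_sum x u n) as CS.
    set (s := sum_n (fun k => (x k * u k)%C) n) in *.
    pose proof (Cmod_triangle t (((0, y) - 0) * s)) as T.
    rewrite Cmod_mult in T.
    assert (H1 : Cmod (t + ((0, y) - 0) * s) ^ 2
      <= 2 * Cmod t ^ 2 + 2 * (y ^ 2 * Cmod s ^ 2)).
    { rewrite <- Hz.
      set (c := Cmod ((0, y) - 0)) in *.
      apply Rle_trans with ((Cmod t + c * Cmod s) ^ 2).
      - apply pow_incr; split; [apply Cmod_ge_0 | exact T].
      - pose proof (pow2_ge_0 (Cmod t - c * Cmod s)); lra. }
    assert (H2 : Cmod s ^ 2 <= F * sqsum u n).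
    { eapply Rle_trans; [exact CS|].
      apply Rmult_le_compat_r; [apply sqsum_nonneg | exact Hx]. }
    assert (H3 : y ^ 2 * Cmod s ^ 2 <= y ^ 2 * (F * sqsum u n))
      by (apply Rmult_le_compat_l; [apply pow2_ge_0 | exact H2]).
    assert (Hy2 : 1 <= y ^ 2) by nra.
    assert (H4 : kappa <= y ^ 2 * sqsum u n) by nra.
    assert (H5 : Cmod t ^ 2 <= Cmod t ^ 2 / kappa * (y ^ 2 * sqsum u n)).
    { replace (Cmod t ^ 2) with (Cmod t ^ 2 / kappa * kappa) at 1 by (field; lra).
      apply Rmult_le_compat_l; [|exact H4].
      apply Rmult_le_pos; [apply pow2_ge_0 | left; now apply Rinv_0_lt_compat]. }
    unfold Rdiv in *; lra. }
  pose proof (Hcs (row0_defect a b (0, y) u) (fun k => poly_p a b k 0) ltac:(lra)) as Hq.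
  pose proof (Hcs (- u 0%nat)%C (fun k => poly_q a b k 0) ltac:(lra)) as Hp.
  rewrite Cmod_opp in Hp.
  fold (coord_q a b (0, y) 0 u n) in Hq; fold (coord_p a b (0, y) 0 u n) in Hp.
  clear Hcs.
  set (P := Cmod (coord_p a b (0, y) 0 u n)) in *.
  set (Q := Cmod (coord_q a b (0, y) 0 u n)) in *.
  assert (HP : 0 <= P) by apply Cmod_ge_0; assert (HQ : 0 <= Q) by apply Cmod_ge_0.
  set (K := sqsum u n) in *.
  assert (HyK : 0 < y ^ 2 * K) by (apply Rmult_lt_0_compat; nra).
  assert (Hsq : (y ^ 2 * K) * K <= P ^ 2 * Q ^ 2).
  { rewrite <- Rpow_mult_distr.
    replace ((y ^ 2 * K) * K) with ((y * K) ^ 2) by ring.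
    apply pow_incr; split; [apply Rmult_le_pos; lra | exact Hprod]. }
  split; apply Rmult_le_reg_l with (y ^ 2 * K); try exact HyK;
    (eapply Rle_trans; [exact Hsq|]).
  - pose proof (Rmult_le_compat_l (P ^ 2) _ _ (pow2_ge_0 P) Hq) as H.
    eapply Rle_trans; [exact H | right; ring].
  - pose proof (Rmult_le_compat_l (Q ^ 2) _ _ (pow2_ge_0 Q) Hp) as H.
    rewrite (Rmult_comm (P ^ 2)).
    eapply Rle_trans; [exact H | right; ring].
Qed.

Lemma sqsum_le_limit_coord y u kappa n :
  1 <= y -> solution a b (0, y) u ->
  Im (row0_defect a b (0, y) u * Cconj (u 0%nat))%C = 0 ->
  0 < kappa -> kappa <= sqsum u 1 ->
  sqsum u n <= (2 * Cmod (row0_defect a b (0, y) u) ^ 2 / kappa + 2 * F)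
               * Cmod (limit_coord_p (0, y) u) ^ 2 /\
  sqsum u n <= (2 * Cmod (u 0%nat) ^ 2 / kappa + 2 * F)
               * Cmod (limit_coord_q (0, y) u) ^ 2.
Proof.
  intros Hy Hu H0 Hk Hk1.
  assert (H : forall m, (S n <= m)%nat ->
    kappa <= sqsum u m /\ sqsum u n <= sqsum u m).
  { intros m Hm; pose proof (sqsum_le u 1 m ltac:(lia)).
    split; [lra | apply sqsum_le; lia]. }
  split.
  - set (c := 2 * Cmod (row0_defect a b (0, y) u) ^ 2 / kappa + 2 * F).
    assert (L : Rbar_le (sqsum u n) (c * Cmod (limit_coord_p (0, y) u) ^ 2)); [|exact L].
    apply is_lim_seq_le_loc with (u := fun _ => sqsum u n)
      (v := fun m => c * Cmod (coord_p a b (0, y) 0 u m) ^ 2).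
    + exists (S n); intros m Hm; destruct (H m Hm) as [H1 H2].
      eapply Rle_trans; [exact H2|].
      now apply (sqsum_le_coord y u kappa m).
    + apply is_lim_seq_const.
    + apply is_lim_seq_mult'; [apply is_lim_seq_const | now apply is_lim_coord_p].
  - set (c := 2 * Cmod (u 0%nat) ^ 2 / kappa + 2 * F).
    assert (L : Rbar_le (sqsum u n) (c * Cmod (limit_coord_q (0, y) u) ^ 2)); [|exact L].
    apply is_lim_seq_le_loc with (u := fun _ => sqsum u n)
      (v := fun m => c * Cmod (coord_q a b (0, y) 0 u m) ^ 2).
    + exists (S n); intros m Hm; destruct (H m Hm) as [H1 H2].
      eapply Rle_trans; [exact H2|].
      now apply (sqsum_le_coord y u kappa m).
    + apply is_lim_seq_const.
    + apply is_lim_seq_mult'; [apply is_lim_seq_const | now apply is_lim_coord_q].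
Qed.

(** The relative growth of the squared norm over two steps. *)
Lemma sqsum_two_steps y u n :
  0 < y -> solution a b (0, y) u ->
  Im (row0_defect a b (0, y) u * Cconj (u 0%nat))%C = 0 ->
  0 < sqsum u n ->
  y ^ 2 * sqsum u n <= 5 * jacobi_lambda a b n ^ 2 * (sqsum u (S (S n)) - sqsum u n).
Proof.
  intros Hy Hu H0 Hk.
  assert (Hg : forall m, y * sqsum u m <= b m * (Cmod (u (S m)) * Cmod (u m))).
  { intro m; pose proof (green a b (0, y) u m Hu) as G.
    rewrite H0, Rplus_0_r in G; change (Im (0, y)) with y in G; rewrite <- G.
    apply Rmult_le_compat_l; [left; apply b_pos|].
    rewrite <- (Cmod_conj (u m)), <- Cmod_mult.
    eapply Rle_trans; [apply Rle_abs|].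
    eapply Rle_trans; [|apply Rmax_Cmod]; apply Rmax_r. }
  pose proof (Hg n) as G0; pose proof (Hg (S n)) as G1.
  pose proof (sqsum_term_le u n) as TU; pose proof (sqsum_term_le u (S n)) as TV.
  rewrite !sqsum_S in *.
  (* The triangle inequality in the row of index n + 1. *)
  assert (Ht : Rabs (a (S n)) * Cmod (u (S n))
    <= b (S n) * Cmod (u (S (S n))) + b n * Cmod (u n)).
  { pose proof (Hu n) as E.
    assert (E' : (((0, y) - a (S n)) * u (S n)
                  = b (S n) * u (S (S n)) + b n * u n)%C) by (rewrite E; ring).
    pose proof (Cmod_triangle (b (S n) * u (S (S n))) (b n * u n)) as T.
    rewrite <- E', !Cmod_mult, !Cmod_R in T.
    rewrite (Rabs_pos_eq (b n)), (Rabs_pos_eq (b (S n))) in T by (left; apply b_pos).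
    eapply Rle_trans; [|exact T].
    apply Rmult_le_compat_r; [apply Cmod_ge_0|].
    eapply Rle_trans; [|apply Rmax_Cmod]; eapply Rle_trans; [|apply Rmax_l].
    simpl; rewrite <- Rabs_Ropp; right; f_equal; ring. }
  pose proof (jacobi_lambda_sq n) as HL.
  rewrite <- (pow2_abs (a (S n))) in HL.
  pose proof (Rabs_pos (a (S n))) as Ha.
  pose proof (Cmod_ge_0 (u n)) as HU; pose proof (Cmod_ge_0 (u (S n))) as HV.
  pose proof (Cmod_ge_0 (u (S (S n)))) as HX.
  pose proof (b_pos n) as Hb; pose proof (b_pos (S n)) as Hb'.
  set (A := Rabs (a (S n))) in *; set (B := b n) in *; set (B' := b (S n)) in *.
  set (U := Cmod (u n)) in *; set (V := Cmod (u (S n))) in *.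
  set (X := Cmod (u (S (S n)))) in *; set (k := sqsum u n) in *.
  set (L := jacobi_lambda a b n) in *.
  clearbody A B B' U V X k L; clear Hg Hu H0.
  assert (Hyk : 0 < y * k) by (apply Rmult_lt_0_compat; assumption).
  assert (HVp : 0 < V) by (destruct HV as [|<-]; [assumption | nra]).
  assert (G1' : y * k <= B' * (X * V)) by nra.
  assert (HA : y * k * A <= 2 * B * B' * U * X).
  { apply Rmult_le_reg_r with V; [exact HVp|].
    pose proof (Rmult_le_compat_l (y * k) _ _ (Rlt_le _ _ Hyk) Ht).
    pose proof (Rmult_le_compat_r (B' * X) _ _ (Rmult_le_pos _ _ (Rlt_le _ _ Hb') HX) G0).
    pose proof (Rmult_le_compat_r (B * U) _ _ (Rmult_le_pos _ _ (Rlt_le _ _ Hb) HU) G1').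
    lra. }
  (* Squaring the three bounds, with U^2 <= k. *)
  assert (S1 : y ^ 2 * k * A ^ 2 <= 4 * (B * B') ^ 2 * X ^ 2).
  { apply Rmult_le_reg_l with k; [exact Hk|].
    apply Rle_trans with ((2 * B * B' * U * X) ^ 2).
    - replace (k * (y ^ 2 * k * A ^ 2)) with ((y * k * A) ^ 2) by ring.
      apply pow_incr; split; [apply Rmult_le_pos; lra | exact HA].
    - replace ((2 * B * B' * U * X) ^ 2) with (U ^ 2 * (4 * (B * B') ^ 2 * X ^ 2)) by ring.
      apply Rmult_le_compat_r; [|exact TU].
      apply Rmult_le_pos; [|apply pow2_ge_0].
      apply Rmult_le_pos; [lra | apply pow2_ge_0]. }
  assert (S2 : y ^ 2 * k <= B ^ 2 * V ^ 2).
  { apply Rmult_le_reg_l with k; [exact Hk|].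
    apply Rle_trans with ((B * (V * U)) ^ 2).
    - replace (k * (y ^ 2 * k)) with ((y * k) ^ 2) by ring.
      apply pow_incr; lra.
    - replace ((B * (V * U)) ^ 2) with (U ^ 2 * (B ^ 2 * V ^ 2)) by ring.
      apply Rmult_le_compat_r; [|exact TU].
      apply Rmult_le_pos; apply pow2_ge_0. }
  assert (S3 : y ^ 2 * k <= B' ^ 2 * X ^ 2).
  { set (k1 := k + V ^ 2) in *.
    assert (Hk1 : 0 < k1) by (unfold k1; pose proof (pow2_ge_0 V); lra).
    apply Rle_trans with (y ^ 2 * k1).
    { apply Rmult_le_compat_l; [apply pow2_ge_0|]; unfold k1.
      pose proof (pow2_ge_0 V); lra. }
    apply Rmult_le_reg_l with k1; [exact Hk1|].
    apply Rle_trans with ((B' * (X * V)) ^ 2).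
    - replace (k1 * (y ^ 2 * k1)) with ((y * k1) ^ 2) by ring.
      apply pow_incr; split; [apply Rmult_le_pos; lra | exact G1].
    - replace ((B' * (X * V)) ^ 2) with (V ^ 2 * (B' ^ 2 * X ^ 2)) by ring.
      apply Rmult_le_compat_r; [|exact TV].
      apply Rmult_le_pos; apply pow2_ge_0. }
  assert (Hr : 0 < A ^ 2 + B ^ 2 + B' ^ 2) by nra.
  apply Rmult_le_reg_r with (A ^ 2 + B ^ 2 + B' ^ 2); [exact Hr|].
  replace (5 * L ^ 2 * (k + V ^ 2 + X ^ 2 - k) * (A ^ 2 + B ^ 2 + B' ^ 2))
    with (5 * (L ^ 2 * (A ^ 2 + B ^ 2 + B' ^ 2)) * (V ^ 2 + X ^ 2)) by ring.
  rewrite HL.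
  pose proof (Rmult_le_compat_r (B' ^ 2) _ _ (pow2_ge_0 B') S2).
  pose proof (Rmult_le_compat_r (B ^ 2) _ _ (pow2_ge_0 B) S3).
  pose proof (pow2_ge_0 (B * B' * V)).
  nra.
Qed.

(** Telescoping of [sqsum_two_steps]: each ratio of squared norms at distance
    two is at least one factor of the product. The start at index 1 keeps the
    squared norm positive also for a solution that vanishes at 0. *)
Lemma log_product_le_sqsum y u kappa N :
  0 < y -> solution a b (0, y) u ->
  Im (row0_defect a b (0, y) u * Cconj (u 0%nat))%C = 0 ->
  0 < kappa -> kappa <= sqsum u 1 ->
  sum_n (fun m => ln (1 + y ^ 2 / (5 * jacobi_lambda a b (S m) ^ 2))) N
  <= 2 * ln (sqsum u (N + 3) / kappa).
Proof.
  intros Hy Hu H0 Hk Hk1.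
  assert (Hpos : forall n, (1 <= n)%nat -> kappa <= sqsum u n).
  { intros n Hn; pose proof (sqsum_le u 1 n Hn); lra. }
  assert (Hstep : forall m, ln (1 + y ^ 2 / (5 * jacobi_lambda a b (S m) ^ 2))
     <= ln (sqsum u (m + 3)) - ln (sqsum u (S m))).
  { intro m.
    pose proof (Hpos (S m) ltac:(lia)) as H1.
    pose proof (sqsum_two_steps y u (S m) Hy Hu H0 ltac:(lra)) as H2.
    replace (S (S (S m))) with (m + 3)%nat in H2 by lia.
    pose proof (Hpos (m + 3)%nat ltac:(lia)) as H3.
    rewrite <- ln_div by lra.
    pose proof (jacobi_lambda_pos (S m)) as Hl.
    set (l := jacobi_lambda a b (S m)) in *.
    assert (Hl2 : 0 < l ^ 2) by (apply pow_lt; exact Hl).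
    assert (Hq : 0 < y ^ 2 / (5 * l ^ 2)).
    { apply Rdiv_lt_0_compat; [apply pow_lt; exact Hy | lra]. }
    apply ln_le; [lra|].
    apply Rmult_le_reg_r with (5 * l ^ 2 * sqsum u (S m)).
    { apply Rmult_lt_0_compat; lra. }
    replace ((1 + y ^ 2 / (5 * l ^ 2)) * (5 * l ^ 2 * sqsum u (S m)))
      with (5 * l ^ 2 * sqsum u (S m) + y ^ 2 * sqsum u (S m)) by (field; lra).
    replace (sqsum u (m + 3) / sqsum u (S m) * (5 * l ^ 2 * sqsum u (S m)))
      with (5 * l ^ 2 * sqsum u (m + 3)) by (field; lra).
    lra. }
  assert (Hsum : sum_n (fun m => ln (1 + y ^ 2 / (5 * jacobi_lambda a b (S m) ^ 2))) N
     <= ln (sqsum u (N + 3)) + ln (sqsum u (N + 2)) - ln (sqsum u 2) - ln (sqsum u 1)).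
  { induction N as [|N IH].
    - rewrite sum_O; specialize (Hstep 0%nat); simpl in *; lra.
    - rewrite sum_n_S_R; specialize (Hstep (S N)).
      replace (S N + 2)%nat with (N + 3)%nat by lia.
      replace (sqsum u (S (S N))) with (sqsum u (N + 2)) in Hstep by (f_equal; lia).
      lra. }
  pose proof (Hpos 2%nat ltac:(lia)) as K2.
  pose proof (Hpos (N + 2)%nat ltac:(lia)) as KN.
  pose proof (ln_le _ _ Hk K2); pose proof (ln_le _ _ Hk Hk1).
  assert (K23 : 0 < sqsum u (N + 2)) by lra.
  pose proof (ln_le _ _ K23 (sqsum_le u (N + 2) (N + 3) ltac:(lia))).
  rewrite ln_div by (try lra; pose proof (Hpos (N + 3)%nat ltac:(lia)); lra).
  lra.
Qed.

End Growth.

(** * Order and convergence exponent *)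

Lemma Rpower_opp_le x y c : 0 < x -> x <= y -> 0 <= c ->
  Rpower y (- c) <= Rpower x (- c).
Proof.
  intros Hx Hxy Hc; rewrite !Rpower_Ropp.
  apply Rinv_le_contravar; [apply exp_pos|].
  apply Rle_Rpower_l; lra.
Qed.

Lemma sum_n_le_compat (f g : nat -> R) n :
  (forall k, (k <= n)%nat -> f k <= g k) -> sum_n f n <= sum_n g n.
Proof.
  intro H; induction n as [|n IH].
  - rewrite !sum_O; apply H; lia.
  - rewrite !sum_n_S_R; apply Rplus_le_compat; [apply IH|]; auto.
Qed.

Lemma sum_n_scal (c : R) (f : nat -> R) n :
  sum_n (fun k => c * f k) n = c * sum_n f n.
Proof. exact (sum_n_mult_l (K := R_Ring) c f n). Qed.

Lemma term_le_sum_n (f : nat -> R) k n :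
  (forall m, 0 <= f m) -> (k <= n)%nat -> f k <= sum_n f n.
Proof.
  intros Hf Hk.
  assert (H0 : forall m, 0 <= sum_n f m).
  { induction m as [|m IH]; [rewrite sum_O; apply Hf|].
    rewrite sum_n_S_R; specialize (Hf (S m)); lra. }
  induction n as [|n IH].
  - replace k with 0%nat by lia; rewrite sum_O; lra.
  - rewrite sum_n_S_R; destruct (Nat.eq_dec k (S n)) as [->|Hne].
    + specialize (H0 n); lra.
    + specialize (IH ltac:(lia)); specialize (Hf (S n)); lra.
Qed.

Lemma dyadic_bracket s x K : 0 < s -> x <= s * 2 ^ K ->
  exists k, (k <= K)%nat /\ x <= s * 2 ^ S k /\ s * 2 ^ k <= Rmax x s.
Proof.
  intro Hs; induction K as [|K IH]; intro HK.
  - exists 0%nat; split; [lia|]; split; simpl in *; [lra|].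
    rewrite Rmult_1_r; apply Rmax_r.
  - destruct (Rle_lt_dec x (s * 2 ^ K)) as [Hx|Hx].
    + destruct (IH Hx) as [k Hk]; exists k; split; [lia | apply Hk].
    + exists K; split; [lia|]; split; [exact HK|].
      apply Rle_trans with (2 := Rmax_l x s); lra.
Qed.

Lemma common_dyadic_bound s (x : nat -> R) N : 0 < s ->
  exists K, forall m, (m <= N)%nat -> x m <= s * 2 ^ K.
Proof.
  intro Hs.
  assert (H1 : forall y, exists K, forall K', (K <= K')%nat -> y <= s * 2 ^ K').
  { intro y; destruct (Pow_x_infinity 2 ltac:(rewrite Rabs_pos_eq; lra) (y / s))
      as [K HK].
    exists K; intros K' HK'; specialize (HK K' HK').
    rewrite Rabs_pos_eq in HK by (apply pow_le; lra).
    apply Rmult_le_reg_r with (/ s); [now apply Rinv_0_lt_compat|].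
    replace (s * 2 ^ K' * / s) with (2 ^ K') by (field; lra).
    unfold Rdiv in HK; lra. }
  induction N as [|N [K HK]].
  - destruct (H1 (x 0%nat)) as [K HK]; exists K; intros m Hm.
    replace m with 0%nat by lia; apply HK; lia.
  - destruct (H1 (x (S N))) as [K' HK'].
    exists (Nat.max K K'); intros m Hm.
    destruct (Nat.eq_dec m (S N)) as [->|Hne]; [apply HK'; lia|].
    apply Rle_trans with (1 := HK m ltac:(lia)).
    apply Rmult_le_compat_l; [lra|]; apply Rle_pow; [lra | lia].
Qed.

(** A power bound for the logarithm of the canonical product of [lam] bounds
    its counting function; summation over dyadic radii then gives the
    convergence of the series. *)
Lemma ex_series_of_log_product (lam : nat -> R) (s D al be : R) :
  (forall m, 0 < lam m) -> 1 <= s -> 0 <= D -> 0 <= be -> be < al ->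
  (forall y N, s <= y ->
     sum_n (fun m => ln (1 + y ^ 2 / (5 * lam m ^ 2))) N <= D * Rpower y be) ->
  ex_series (fun m => Rpower (lam m) (- al)).
Proof.
  intros Hlam Hs HD Hbe Hal Hsum.
  assert (Hq : forall y m, 0 < y -> 0 < y ^ 2 / (5 * lam m ^ 2)).
  { intros y m Hy; apply Rdiv_lt_0_compat; [now apply pow_lt|].
    pose proof (pow_lt (lam m) 2 (Hlam m)); lra. }
  assert (Hln0 : forall y m, 0 < y -> 0 <= ln (1 + y ^ 2 / (5 * lam m ^ 2))).
  { intros y m Hy; rewrite <- ln_1; apply ln_le; [lra|].
    specialize (Hq y m Hy); lra. }
  assert (H65 : 0 < ln (6 / 5)) by (rewrite <- ln_1; apply ln_increasing; lra).
  assert (Hln1 : forall y m, 0 < y -> lam m <= y ->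
    ln (6 / 5) <= ln (1 + y ^ 2 / (5 * lam m ^ 2))).
  { intros y m Hy Hle; apply ln_le; [lra|].
    pose proof (pow_lt (lam m) 2 (Hlam m)) as Hl2.
    assert (H : 1 / 5 <= y ^ 2 / (5 * lam m ^ 2)); [|lra].
    apply Rmult_le_reg_r with (5 * lam m ^ 2); [lra|].
    replace (y ^ 2 / (5 * lam m ^ 2) * (5 * lam m ^ 2)) with (y ^ 2)
      by (specialize (Hlam m); field; lra).
    pose proof (pow_incr (lam m) y 2 ltac:(split; [left; apply Hlam | exact Hle])); lra. }
  (* The terms below the radius s are finite in number. *)
  assert (Hev : exists n1, forall m, (n1 <= m)%nat -> s < lam m).
  { assert (Hex : ex_series (fun m => ln (1 + s ^ 2 / (5 * lam m ^ 2)))).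
    { apply ex_series_bounded with (D * Rpower s be).
      - intro m; apply Hln0; lra.
      - intro N; apply Hsum; lra. }
    apply ex_series_lim_0, is_lim_seq_spec in Hex.
    destruct (Hex (mkposreal _ H65)) as [n1 Hn1]; exists n1; intros m Hm.
    destruct (Rlt_le_dec s (lam m)) as [H|H]; [exact H|].
    specialize (Hn1 m Hm).
    change (Rabs (ln (1 + s ^ 2 / (5 * lam m ^ 2)) - 0) < ln (6 / 5)) in Hn1.
    rewrite Rminus_0_r in Hn1.
    pose proof (Hln1 s m ltac:(lra) H).
    pose proof (Rle_abs (ln (1 + s ^ 2 / (5 * lam m ^ 2)))); lra. }
  set (Y := fun k => s * 2 ^ S k).
  assert (HY : forall k, 2 ^ k <= Y k /\ s <= Y k).
  { intro k; unfold Y; simpl; pose proof (pow_R1_Rle 2 k ltac:(lra)); split; nra. }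
  set (G := fun k m => Rpower (Y k) (- al) * ln (1 + Y k ^ 2 / (5 * lam m ^ 2))).
  assert (HG : forall k m, 0 <= G k m).
  { intros k m; apply Rmult_le_pos; [left; apply exp_pos|].
    apply Hln0; specialize (HY k); lra. }
  set (c0 := Rpower 2 al / ln (6 / 5)).
  assert (Hc0 : 0 < c0) by (apply Rdiv_lt_0_compat; [apply exp_pos | exact H65]).
  set (h := fun m => Rpower (Rmax (lam m) s) (- al)).
  assert (Hh : forall K m, lam m <= s * 2 ^ K -> h m <= c0 * sum_n (fun k => G k m) K).
  { intros K m HK.
    destruct (dyadic_bracket s (lam m) K ltac:(lra) HK) as (k & HkK & Hk1 & Hk2).
    apply Rle_trans with (c0 * G k m).
    2: { apply Rmult_le_compat_l; [lra|].
         apply (term_le_sum_n (fun k => G k m)); [intro; apply HG | exact HkK]. }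
    assert (Hp : 0 < s * 2 ^ k) by (apply Rmult_lt_0_compat; [lra | apply pow_lt; lra]).
    apply Rle_trans with (Rpower (s * 2 ^ k) (- al)).
    { unfold h; apply Rpower_opp_le; lra. }
    assert (E : Rpower (s * 2 ^ k) (- al) = Rpower 2 al * Rpower (Y k) (- al)).
    { unfold Y; replace (s * 2 ^ S k) with (2 * (s * 2 ^ k)) by (simpl; ring).
      rewrite <- (Rpower_mult_distr 2 (s * 2 ^ k)) by lra.
      rewrite <- Rmult_assoc, <- Rpower_plus, Rplus_opp_r, Rpower_O by lra; ring. }
    rewrite E; unfold c0, G.
    pose proof (Hln1 (Y k) m ltac:(specialize (HY k); lra) Hk1) as H1.
    replace (Rpower 2 al * Rpower (Y k) (- al))
      with (Rpower 2 al / ln (6 / 5) * (Rpower (Y k) (- al) * ln (6 / 5))) by (field; lra).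
    apply Rmult_le_compat_l; [fold c0; lra|].
    apply Rmult_le_compat_l; [left; apply exp_pos | exact H1]. }
  set (q := Rpower 2 (be - al)).
  assert (Hq0 : 0 < q) by apply exp_pos.
  assert (Hq1 : q < 1).
  { unfold q; rewrite <- (Rpower_O 2) by lra; apply Rpower_lt; lra. }
  assert (Hqs : Rabs q < 1) by (rewrite Rabs_pos_eq; lra).
  assert (HGs : forall k N, sum_n (fun m => G k m) N <= D * q ^ k).
  { intros k N; unfold G; rewrite sum_n_scal.
    destruct (HY k) as [HY1 HY2].
    apply Rle_trans with (Rpower (Y k) (- al) * (D * Rpower (Y k) be)).
    { apply Rmult_le_compat_l; [left; apply exp_pos | now apply Hsum]. }
    replace (Rpower (Y k) (- al) * (D * Rpower (Y k) be))
      with (D * (Rpower (Y k) be * Rpower (Y k) (- al))) by ring.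
    rewrite <- Rpower_plus; apply Rmult_le_compat_l; [exact HD|].
    replace (be + - al) with (- (al - be)) by ring.
    apply Rle_trans with (Rpower (2 ^ k) (- (al - be))).
    { apply Rpower_opp_le; [apply pow_lt; lra | exact HY1 | lra]. }
    right; rewrite <- (Rpower_pow k q Hq0), <- (Rpower_pow k 2) by lra.
    unfold q; rewrite !Rpower_mult; f_equal; ring. }
  assert (Hexh : ex_series h).
  { apply ex_series_bounded with (c0 * (D * / (1 - q))).
    - intro m; left; apply exp_pos.
    - intro N; destruct (common_dyadic_bound s lam N ltac:(lra)) as [K HK].
      apply Rle_trans with (sum_n (fun m => c0 * sum_n (fun k => G k m) K) N).
      { apply sum_n_le_compat; intros m Hm; apply Hh, HK, Hm. }
      rewrite sum_n_scal; apply Rmult_le_compat_l; [lra|].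
      rewrite (sum_n_switch (G := R_AbelianMonoid) (fun m k => G k m)).
      apply Rle_trans with (sum_n (fun k => D * q ^ k) K).
      { apply sum_n_le_compat; intros k _; apply HGs. }
      rewrite sum_n_scal; apply Rmult_le_compat_l; [exact HD|].
      rewrite <- Series_geom by exact Hqs.
      apply sum_n_le_Series; [intro; apply pow_le; lra | now apply ex_series_geom]. }
  destruct Hev as [n1 Hn1].
  apply (ex_series_incr_n _ n1); apply (ex_series_incr_n _ n1) in Hexh.
  apply ex_series_ext with (2 := Hexh); intro m; unfold h.
  specialize (Hn1 (n1 + m)%nat ltac:(lia)); now rewrite Rmax_left by lra.
Qed.

Lemma limsup_lt_eventually (g : R -> R) (be : R) :
  Rbar_lt (limsup_p_infty g) be -> exists s, forall r, s <= r -> g r <= be.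
Proof.
  intro H; apply NNPP; intro Hn.
  apply (Rbar_lt_not_le _ _ H).
  unfold limsup_p_infty, Rbar_glb.
  apply (proj2 (proj2_sig (Rbar_ex_glb _))); intros x [s ->].
  assert (Hr : exists r, s <= r /\ be < g r).
  { apply NNPP; intro Hr; apply Hn; exists s; intros r Hsr.
    apply Rnot_lt_le; intro Hlt; apply Hr; now exists r. }
  destruct Hr as (r & Hsr & Hr).
  apply Rbar_le_trans with (g r); [simpl; lra|].
  apply (proj1 (Lub_Rbar_correct (fun x => exists r, s <= r /\ x = g r))).
  now exists r.
Qed.

(** If [m <= 1], the value of [ln (ln m)] is a default one, but then the bound is
    trivial as [ln m] is not positive. *)
Lemma ln_le_Rpower_of_lnln m r be : 1 < r -> 0 < m -> ln (ln m) / ln r <= be ->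
  ln m <= Rpower r be.
Proof.
  intros Hr Hm H.
  destruct (Rle_lt_dec (ln m) 0) as [H0|H0].
  - apply Rle_trans with (1 := H0); left; apply exp_pos.
  - rewrite <- (exp_ln (ln m)) by exact H0; unfold Rpower.
    assert (Hlr : 0 < ln r) by (rewrite <- ln_1; apply ln_increasing; lra).
    assert (H1 : ln (ln m) <= be * ln r).
    { apply Rmult_le_reg_r with (/ ln r); [now apply Rinv_0_lt_compat|].
      replace (be * ln r * / ln r) with be by (field; lra); exact H. }
    destruct H1 as [H1|H1]; [left; now apply exp_increasing | rewrite H1; lra].
Qed.

(** The comparison of exponents, for any function whose maximum modulus
    dominates a power of the canonical product. *)
Lemma convergence_exponent_le_order (lam : nat -> R) (f : C -> C) (c : R) :
  (forall m, 0 < lam m) ->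
  (forall y N, 1 <= y -> 0 < max_modulus f y /\
     sum_n (fun m => ln (1 + y ^ 2 / (5 * lam (S m) ^ 2))) N
     <= c + 4 * ln (max_modulus f y)) ->
  Rbar_le (convergence_exponent lam) (entire_order f).
Proof.
  intros Hlam Hgrow.
  destruct (Rbar_lt_le_dec (entire_order f) (convergence_exponent lam)) as [Hlt|Hle];
    [exfalso | exact Hle].
  assert (Hsep : exists be al : R, Rbar_lt (entire_order f) be /\ be < al /\
                   Rbar_lt al (convergence_exponent lam)).
  { destruct (entire_order f) as [o| |], (convergence_exponent lam) as [e| |];
      try contradiction; simpl in Hlt.
    - exists (o + (e - o) / 3), (o + 2 * (e - o) / 3); simpl; lra.
    - exists (o + 1), (o + 2); simpl; lra.
    - exists (e - 2), (e - 1); simpl; lra.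
    - exists 0, 1; simpl; lra. }
  destruct Hsep as (be & al & Hbe & Hba & Hal).
  destruct (limsup_lt_eventually _ _ Hbe) as [s Hs].
  set (M := max_modulus f) in *.
  set (s1 := Rmax s 2).
  assert (Hs1 : s <= s1 /\ 2 <= s1) by (split; [apply Rmax_l | apply Rmax_r]).
  assert (HM : forall y, s1 <= y -> ln (M y) <= Rpower y be).
  { intros y Hy; apply ln_le_Rpower_of_lnln; [lra | | apply Hs; lra].
    apply (Hgrow y 0%nat); lra. }
  (* A negative bound would keep the maximum modulus bounded, while already the
     first factor of the product tends to infinity. *)
  assert (Hbe0 : 0 <= be).
  { apply Rnot_lt_le; intro Hneg.
    set (e := exp (Rabs c + 4)).
    set (l := 5 * lam 1%nat ^ 2).
    assert (Hl : 0 < l) by (pose proof (pow_lt _ 2 (Hlam 1%nat)); unfold l; lra).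
    assert (He : 0 < e) by apply exp_pos.
    set (y := Rmax s1 (l * e)).
    assert (Hy1 : s1 <= y) by apply Rmax_l.
    assert (Hy2 : l * e <= y) by apply Rmax_r.
    destruct (Hgrow y 0%nat ltac:(lra)) as [_ H]; rewrite sum_O in H.
    fold l in H.
    pose proof (HM y Hy1) as H1.
    assert (H2 : Rpower y be <= 1).
    { rewrite <- (Rpower_O y) by lra; apply Rle_Rpower; lra. }
    assert (H3 : Rabs c + 4 < ln (1 + y ^ 2 / l)).
    { rewrite <- (ln_exp (Rabs c + 4)); fold e; apply ln_increasing; [exact He|].
      assert (H4 : e <= y ^ 2 / l); [|lra].
      apply Rmult_le_reg_r with l; [exact Hl|].
      replace (y ^ 2 / l * l) with (y ^ 2) by (field; lra); nra. }
    pose proof (Rle_abs c); lra. }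
  assert (Hex : ex_series (fun m => Rpower (lam (S m)) (- al))).
  { apply ex_series_of_log_product with s1 (Rabs c + 4) be; try lra.
    - intro m; apply Hlam.
    - pose proof (Rabs_pos c); lra.
    - intros y N Hy.
      destruct (Hgrow y N ltac:(lra)) as [_ H].
      specialize (HM y Hy).
      assert (H1 : 1 <= Rpower y be).
      { rewrite <- (Rpower_O y) by lra; apply Rle_Rpower; lra. }
      pose proof (Rle_abs c); pose proof (Rabs_pos c); nra. }
  apply (Rbar_lt_not_le _ _ Hal).
  apply (proj1 (Glb_Rbar_correct (fun alpha =>
    0 < alpha /\ ex_series (fun n => Rpower (Rabs (lam n)) (- alpha))))).
  split; [lra|].
  apply ex_series_incr_1; apply ex_series_ext with (2 := Hex).
  intro m; now rewrite Rabs_pos_eq by (left; apply Hlam).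
Qed.

Lemma convergence_exponent_le (x y : nat -> R) :
  (forall n, 0 < x n) -> (forall n, x n <= y n) ->
  Rbar_le (convergence_exponent y) (convergence_exponent x).
Proof.
  intros Hx Hxy.
  unfold convergence_exponent at 2.
  apply (proj2 (Glb_Rbar_correct _)).
  intros al [Hal Hex].
  apply (proj1 (Glb_Rbar_correct (fun alpha =>
    0 < alpha /\ ex_series (fun n => Rpower (Rabs (y n)) (- alpha))))).
  split; [exact Hal|].
  apply (ex_series_le (V := R_CompleteNormedModule)) with (2 := Hex).
  intro n; change (Rabs (Rpower (Rabs (y n)) (- al)) <= Rpower (Rabs (x n)) (- al)).
  specialize (Hx n); specialize (Hxy n).
  rewrite Rabs_pos_eq by (left; apply exp_pos).
  rewrite !Rabs_pos_eq by lra.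
  apply Rpower_opp_le; lra.
Qed.

Lemma Cmod_le_max_modulus (f : C -> C) (r B : R) z :
  (forall z, Cmod z = r -> Cmod (f z) <= B) -> Cmod z = r ->
  Cmod (f z) <= max_modulus f r.
Proof.
  intros HB Hz; unfold max_modulus.
  destruct (Lub_Rbar_correct (fun m => exists z, Cmod z = r /\ m = Cmod (f z)))
    as [Hub Hleast].
  pose proof (Hub (Cmod (f z)) (ex_intro _ z (conj Hz eq_refl))) as H1.
  assert (H2 : Rbar_le (Lub_Rbar (fun m => exists z, Cmod z = r /\ m = Cmod (f z))) B).
  { apply Hleast; intros x (z' & Hz' & ->); simpl; now apply HB. }
  destruct Lub_Rbar; simpl in *; tauto.
Qed.

(** * Entries of the Nevanlinna matrix *)

Section Entries.

Variables (a b : nat -> R).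
Hypothesis b_pos : forall n, 0 < b n.
Hypothesis a_b_limit_circle : limit_circle a b.

(** The comparison for a limiting coordinate of a family of solutions whose
    initial data are real and do not depend on the spectral parameter. *)
Lemma order_limit_coord (u : C -> nat -> C) (u0 d kappa : R) (f : C -> C) :
  (forall z, solution a b z (u z)) ->
  (forall z, u z 0%nat = u0) ->
  (forall z, row0_defect a b z (u z) = d) ->
  0 < kappa -> (forall z, kappa <= sqsum (u z) 1) ->
  (forall z, f z = limit_coord_p a b z (u z)) \/
  (forall z, f z = limit_coord_q a b z (u z)) ->
  Rbar_le (convergence_exponent (jacobi_lambda a b)) (entire_order f).
Proof.
  intros Hu Hu0 Hd Hk Hku Hf.
  destruct (limit_circle_fund a b b_pos a_b_limit_circle) as [F HF].
  assert (Hreal : forall z, Im (row0_defect a b z (u z) * Cconj (u z 0%nat))%C = 0).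
  { intro z; rewrite Hu0, Hd; simpl; ring. }
  assert (Hup : forall r z, Cmod z = r ->
    Cmod (f z) <= (Rabs u0 + Rabs d) * exp (r * F)).
  { intros r z <-.
    pose proof (limit_coord_upper a b b_pos F HF z (u z) (Hu z)) as H; cbv zeta in H.
    rewrite Hu0, Hd, !Cmod_R in H.
    apply Rsqr_incr_0_var.
    - rewrite !Rsqr_pow2; destruct Hf as [Hf|Hf]; rewrite Hf; apply H.
    - apply Rmult_le_pos; [|left; apply exp_pos].
      pose proof (Rabs_pos u0); pose proof (Rabs_pos d); lra. }
  assert (Hlow : exists c, forall y n, 1 <= y ->
    sqsum (u (0, y)) n <= c * Cmod (f (0, y)) ^ 2).
  { destruct Hf as [Hf|Hf]; eexists; intros y n Hy; rewrite Hf;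
      destruct (sqsum_le_limit_coord a b b_pos F HF y (u (0, y)) kappa n Hy
                  (Hu _) (Hreal _) Hk (Hku _)) as [H1 H2];
      rewrite Hd, Cmod_R in H1; rewrite Hu0, Cmod_R in H2;
      [exact H1 | exact H2]. }
  destruct Hlow as [c Hlow].
  apply convergence_exponent_le_order with (2 * ln (c / kappa));
    [apply jacobi_lambda_pos; exact b_pos|].
  intros y N Hy.
  assert (Hz : Cmod (0, y) = y).
  { apply Rsqr_inj; [apply Cmod_ge_0 | lra|].
    rewrite !Rsqr_pow2, Cmod2_alt; simpl; ring. }
  pose proof (Cmod_le_max_modulus f y _ (0, y) (Hup y) Hz) as HM.
  assert (HS : kappa <= sqsum (u (0, y)) (N + 3)).
  { apply Rle_trans with (1 := Hku (0, y)); apply sqsum_le; lia. }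
  pose proof (Hlow y (N + 3)%nat Hy) as Hl.
  pose proof (Cmod_ge_0 (f (0, y))) as Hf0.
  assert (Hfpos : 0 < Cmod (f (0, y))).
  { destruct Hf0 as [H|H]; [exact H|].
    rewrite <- H in Hl; lra. }
  assert (Hf2 : 0 < Cmod (f (0, y)) ^ 2) by (apply pow_lt; exact Hfpos).
  assert (Hc : 0 < c) by nra.
  split; [lra|].
  eapply Rle_trans.
  { apply (log_product_le_sqsum a b b_pos y (u (0, y)) kappa N); auto; lra. }
  pose proof (ln_le _ _ Hfpos HM) as Hlm.
  assert (H1 : ln (sqsum (u (0, y)) (N + 3) / kappa)
               <= ln (c / kappa * Cmod (f (0, y)) ^ 2)).
  { apply ln_le; [apply Rdiv_lt_0_compat; lra|].
    unfold Rdiv; rewrite (Rmult_comm c), Rmult_assoc, (Rmult_comm (/ kappa)).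
    apply Rmult_le_compat_r; [left; now apply Rinv_0_lt_compat | exact Hl]. }
  rewrite ln_mult in H1 by (try apply Rdiv_lt_0_compat; assumption).
  rewrite ln_pow in H1 by exact Hfpos; simpl INR in H1; lra.
Qed.

Lemma order_nevanlinna_entry i j : (i < 2)%nat -> (j < 2)%nat ->
  Rbar_le (convergence_exponent (jacobi_lambda a b))
          (entire_order (nevanlinna_entry a b i j)).
Proof.
  intros Hi Hj.
  assert (Hp : forall f : C -> C,
    (forall z, f z = limit_coord_p a b z (fun n => poly_p a b n z)) \/
    (forall z, f z = limit_coord_q a b z (fun n => poly_p a b n z)) ->
    Rbar_le (convergence_exponent (jacobi_lambda a b)) (entire_order f)).
  { intros f Hf.
    apply order_limit_coord with (fun z n => poly_p a b n z) 1 0 1; auto.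
    - intro z; now apply poly_p_solution.
    - intro z; now apply poly_p_row0.
    - lra.
    - intro z; pose proof (sqsum_le (fun n => poly_p a b n z) 0 1 ltac:(lia)) as H.
      rewrite sqsum_0 in H; change (poly_p a b 0 z) with (RtoC 1) in H.
      rewrite Cmod_1 in H; lra. }
  assert (Hq : forall f : C -> C,
    (forall z, f z = limit_coord_p a b z (fun n => poly_q a b n z)) \/
    (forall z, f z = limit_coord_q a b z (fun n => poly_q a b n z)) ->
    Rbar_le (convergence_exponent (jacobi_lambda a b)) (entire_order f)).
  { intros f Hf.
    pose proof (b_pos 0%nat) as Hb0.
    apply order_limit_coord with (fun z n => poly_q a b n z) 0 1 ((1 / b 0%nat) ^ 2); auto.
    - intro z; now apply poly_q_solution.
    - intro z; now apply poly_q_row0.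
    - apply pow_lt, Rdiv_lt_0_compat; lra.
    - intro z; eapply Rle_trans; [|apply sqsum_term_le]; cbv beta.
      replace (poly_q a b 1 z) with (RtoC (1 / b 0%nat)).
      + rewrite Cmod_R, pow2_abs; lra.
      + unfold poly_q; simpl; rewrite RtoC_div by lra; reflexivity. }
  destruct i as [|[|i]]; [| |lia]; (destruct j as [|[|j]]; [| |lia]).
  - apply Hq; left; intro z.
    change (nevanlinna_entry a b 0 0 z) with (nev_A a b z).
    unfold nev_A, limit_coord_p; change (poly_q a b 0 z) with (RtoC 0); ring.
  - apply Hq; right; intro z.
    change (nevanlinna_entry a b 0 1 z) with (nev_C a b z).
    unfold nev_C, limit_coord_q; now rewrite poly_q_row0.
  - apply Hp; left; intro z; reflexivity.
  - apply Hp; right; intro z.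
    change (nevanlinna_entry a b 1 1 z) with (nev_D a b z).
    unfold nev_D, limit_coord_q; rewrite poly_p_row0 by exact b_pos; ring.
Qed.

End Entries.

Theorem corollary3p9 :
  forall (a b : nat -> R),
    (forall n : nat, 0 < b n) ->
    limit_circle a b ->
    forall i j : nat, (i < 2)%nat -> (j < 2)%nat ->
      Rbar_le
        (convergence_exponent
           (fun n => b n * b (S n) /
                     sqrt ((a (S n)) ^ 2 + (b n) ^ 2 + (b (S n)) ^ 2)))
        (entire_order (nevanlinna_entry a b i j)) /\
      Rbar_le
        (convergence_exponent b)
        (entire_order (nevanlinna_entry a b i j)).
Proof.
  intros a b b_pos Hlc i j Hi Hj.
  pose proof (order_nevanlinna_entry a b b_pos Hlc i j Hi Hj) as H.
  split; [exact H|].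
  apply Rbar_le_trans with (2 := H).
  apply convergence_exponent_le.
  - intro n; now apply jacobi_lambda_pos.
  - intro n; now apply jacobi_lambda_le.
Qed.
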